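(* Let $(\mathcal A,\mathcal B,\mathcal C)$ be a recollement of length categories with finitely many isomorphism classes of simple objects, enough projective objects and enough injective objects, with functors $i:\mathcal A\to\mathcal B$, $q,p:\mathcal B\to\mathcal A$, $e:\mathcal B\to\mathcal C$, $l,r:\mathcal C\to\mathcal B$. Assume that $$\operatorname{pgl.dim}_{\mathcal B}\mathcal A:=\sup\{\operatorname{pd}_{\mathcal B}i(A)\mid A\in\mathcal A\}\le1.$$ Let $L_l=\max\{\ell_{\mathcal B}(lT)\mid T\in\operatorname{simp}\mathcal C\}$ and $L_r=\max\{\ell_{\mathcal A}(Y'_S)\mid S\in\operatorname{simp}\mathcal B\}$, where $\ell$ denotes composition length, $\operatorname{simp}$ denotes simple objects, and for a simple object $S$ of $\mathcal B$, $Y'_S\in\mathcal A$ is a fixed object such that $i(Y'_S)$ is isomorphic to the cokernel of the unit morphism $S\to re(S)$. Then $\operatorname{gl.dim}\mathcal A\le1$. Moreover, for every $k\ge1$, $$k\text{-}\operatorname{ddell}(\mathcal C)\le L_l\bigl(k\text{-}\operatorname{ddell}(\mathcal B)+1\bigr)-1\quad\text{and}\quad k\text{-}\operatorname{ddell}(\mathcal B)\le k\text{-}\operatorname{ddell}(\mathcal C)+2L_r+3.$$ Consequently, $k\text{-}\operatorname{ddell}(\mathcal B)<\infty$ if and only if $k\text{-}\operatorname{ddell}(\mathcal C)<\infty$.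
   Context: A recollement of abelian categories $(\mathcal A,\mathcal B,\mathcal C)$ consists of functors $i:\mathcal A\to\mathcal B$, $q,p:\mathcal B\to\mathcal A$, $e:\mathcal B\to\mathcal C$, $l,r:\mathcal C\to\mathcal B$ such that $(q,i,p)$ and $(l,e,r)$ are adjoint triples ($q\dashv i\dashv p$, $l\dashv e\dashv r$), the functors $i,l,r$ are fully faithful, and $\operatorname{Im}i=\operatorname{Ker}e$. Then $i,e$ are exact, and for every $X\in\mathcal B$ there is an exact sequence $0\to ip(X)\to X\to re(X)\to i(Y'_X)\to0$ with $Y'_X\in\mathcal A$, where $X\to re(X)$ is the unit of $e\dashv r$. Abelian categories are essentially small and have enough projective objects. For such a category $\mathcal A$, $\operatorname{Proj}\mathcal A$ is the full subcategory of projective objects and $\underline{\mathcal A}=\mathcal A/[\operatorname{Proj}\mathcal A]$ is the stable category. For each $X$ choose an epimorphism $P_X\to X$ with $P_X$ projective and put $\Omega X=\operatorname{Ker}(P_X\to X)$; this induces an additive endofunctor $\Omega$ of $\underline{\mathcal A}$, $\Omega^0=\operatorname{id}$. $U$ is a stable retract of $V$ if $U$ is a retract of $V$ in $\underline{\mathcal A}$. For $k\ge1$ and $X\in\mathcal A$ (with $\inf\emptyset=\infty$): - $k\text{-}\operatorname{dell}_{\mathcal A}X=\inf\{n\ge0\mid \Omega^nX$ is a stable retract of $\Omega^{n+k}Y$ for some $Y\in\mathcal A\}$; - $k\text{-}\operatorname{ddell}_{\mathcal A}X=\inf\{m\ge0\mid$ there exist $0\le t\le m$ and an exact sequence $0\to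 C_t\to\cdots\to C_0\to X\to0$ with $(i+k)\text{-}\operatorname{dell}_{\mathcal A}C_i\le m-i$ for $0\le i\le t\}$. A length category is a skeletally small abelian category in which every object has a finite composition series. For a length category with finitely many isomorphism classes of simple objects, $k\text{-}\operatorname{ddell}(\mathcal A)=\sup\{k\text{-}\operatorname{ddell}_{\mathcal A}S\mid S\text{ simple in }\mathcal A\}$. $\operatorname{gl.dim}\mathcal A=\sup\{\operatorname{pd}_{\mathcal A}A\mid A\in\mathcal A\}$. An expression on the right-hand side of an inequality is understood to be $\infty$ whenever one of the derived delooping levels occurring in it is infinite. *)

(* Defs.v *)
From mathcomp Require Import all_boot all_algebra.
From mathcomp Require Import boolp.

Set Implicit Arguments.
Unset Strict Implicit.
Unset Printing Implicit Defensive.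

Import GRing.Theory.

(* The extended natural numbers, with None as the value oo. *)
Definition enat := option nat.

Declare Scope enat_scope.
Delimit Scope enat_scope with en.
Bind Scope enat_scope with enat.

Definition ele (x y : enat) : bool :=
  match x, y with
  | _, None => true
  | Some m, Some n => m <= n
  | None, Some _ => false
  end.

Definition eadd (x y : enat) : enat :=
  if x is Some m then (if y is Some n then Some (m + n) else None) else None.

(* oo is absorbing for the product too: 0 * oo = oo. *)
Definition emul (x y : enat) : enat :=
  if x is Some m then (if y is Some n then Some (m * n) else None) else None.

(* Truncated subtraction; oo - n = oo. *)
Definition esubn (x : enat) (n : nat) : enat :=
  if x is Some m then Some (m - n) else None.

Notation "x <= y" := (ele x y) : enat_scope.
Notation "x + y" := (eadd x y) : enat_scope.
Notation "x * y" := (emul x y) : enat_scope.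
Notation "x - n" := (esubn x n%N) : enat_scope.
Notation "n %:E" := (Some n%N : enat)
  (at level 2, left associativity, format "n %:E") : enat_scope.

Lemma ex_asbool (P : nat -> Prop) : (exists n, P n) -> exists n, `[< P n >].
Proof. by case=> n Pn; exists n; apply/asboolP. Qed.

(* The least n such that P n, with inf of the empty set equal to oo. *)
Definition einf (P : nat -> Prop) : enat :=
  if pselect (exists n, P n) is left h then Some (ex_minn (ex_asbool h))
  else None.

(* The least upper bound in {0, 1, 2, ..., oo} of the f x such that D x; in
   particular the supremum of the empty family is 0. *)
Definition esup (I : Type) (D : I -> Prop) (f : I -> enat) : enat :=
  einf (fun n => forall x, D x -> (f x <= n%:E)%en).

(* The objects form a type, so every category here is small. *)
Record preadditive := Preadditive {
  obj :> Type;
  hom : obj -> obj -> zmodType;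
  idm : forall X, hom X X;
  comp : forall X Y Z, hom Y Z -> hom X Y -> hom X Z;
  compA : forall W X Y Z (h : hom Y Z) (g : hom X Y) (f : hom W X),
    comp h (comp g f) = comp (comp h g) f;
  comp1m : forall X Y (f : hom X Y), comp (idm Y) f = f;
  compm1 : forall X Y (f : hom X Y), comp f (idm X) = f;
  compDl : forall X Y Z (g g' : hom Y Z) (f : hom X Y),
    comp (g + g')%R f = (comp g f + comp g' f)%R;
  compDr : forall X Y Z (g : hom Y Z) (f f' : hom X Y),
    comp g (f + f')%R = (comp g f + comp g f')%R
}.

Arguments hom {p} X Y.
Arguments idm {p} X.
Arguments comp {p X Y Z} g f.

Declare Scope cat_scope.
Delimit Scope cat_scope with cat.
Notation "g \oc f" := (comp g f)
  (at level 40, left associativity) : cat_scope.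
Local Open Scope cat_scope.

Section Preadditive.
Variable A : preadditive.
Implicit Types X Y Z : A.

Definition is_mono X Y (f : hom X Y) : Prop :=
  forall W (g h : hom W X), f \oc g = f \oc h -> g = h.

Definition is_epi X Y (f : hom X Y) : Prop :=
  forall Z (g h : hom Y Z), g \oc f = h \oc f -> g = h.

Definition is_iso X Y (f : hom X Y) : Prop :=
  exists g : hom Y X, g \oc f = idm X /\ f \oc g = idm Y.

Definition isomorphic X Y : Prop := exists f : hom X Y, is_iso f.

Definition is_zero X : Prop :=
  forall Y, (forall f : hom X Y, f = 0%R) /\ (forall g : hom Y X, g = 0%R).

Definition is_kernel X Y (f : hom X Y) K (k : hom K X) : Prop :=
  f \oc k = 0%R /\
  forall W (h : hom W X), f \oc h = 0%R -> exists! u : hom W K, k \oc u = h.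

Definition is_cokernel X Y (f : hom X Y) Q (q : hom Y Q) : Prop :=
  q \oc f = 0%R /\
  forall W (h : hom Y W), h \oc f = 0%R -> exists! u : hom Q W, u \oc q = h.

Definition is_biproduct X Y S
    (i1 : hom X S) (i2 : hom Y S) (p1 : hom S X) (p2 : hom S Y) : Prop :=
  [/\ p1 \oc i1 = idm X, p2 \oc i2 = idm Y, p1 \oc i2 = 0%R, p2 \oc i1 = 0%R
    & (i1 \oc p1 + i2 \oc p2)%R = idm S].

Definition is_abelian : Prop :=
  (exists Z : A, is_zero Z) /\
  (forall X Y, exists S (i1 : hom X S) (i2 : hom Y S) (p1 : hom S X)
     (p2 : hom S Y), is_biproduct i1 i2 p1 p2) /\
  (forall X Y (f : hom X Y), exists K (k : hom K X), is_kernel f k) /\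
  (forall X Y (f : hom X Y), exists Q (q : hom Y Q), is_cokernel f q) /\
  (forall X Y (f : hom X Y), is_mono f ->
     exists Z (g : hom Y Z), is_kernel g f) /\
  (forall X Y (f : hom X Y), is_epi f ->
     exists Z (g : hom Z X), is_cokernel g f).

(* Exactness of X -> Y -> Z at Y: f = k u with u epi and k a kernel of g, that
   is, the image of f is the kernel of g. *)
Definition exact X Y Z (f : hom X Y) (g : hom Y Z) : Prop :=
  exists K (k : hom K Y) (u : hom X K),
    [/\ is_kernel g k, is_epi u & f = k \oc u].

Definition short_exact X Y Z (f : hom X Y) (g : hom Y Z) : Prop :=
  [/\ is_mono f, exact f g & is_epi g].

(* An exact sequence 0 -> C_t -> ... -> C_0 -> X -> 0, stored as an infinite
   sequence whose terms beyond C_t are zero objects. *)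
Definition exact_resolution (t : nat) (C : nat -> A)
    (d : forall j, hom (C j.+1) (C j)) X (a : hom (C 0) X) : Prop :=
  [/\ is_epi a, exact (d 0) a, forall j, exact (d j.+1) (d j)
    & forall j, t < j -> is_zero (C j)].

Definition simple X : Prop :=
  ~ is_zero X /\
  forall U (f : hom U X), is_mono f -> is_zero U \/ is_iso f.

(* X has a filtration 0 = X_0 < ... < X_n = X with simple subquotients. *)
Inductive composition_series : A -> nat -> Prop :=
| comp_series0 X : is_zero X -> composition_series X 0
| comp_seriesS X Y S n (f : hom X Y) (g : hom Y S) :
    composition_series X n -> short_exact f g -> simple S ->
    composition_series Y n.+1.

Definition clength X : enat := einf (composition_series X).

Definition is_length_category : Prop :=
  is_abelian /\ forall X, exists n, composition_series X n.

Definition finitely_many_simples : Prop :=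
  exists n (T : 'I_n -> A), forall S, simple S -> exists j, isomorphic S (T j).

Definition projective P : Prop :=
  forall X Y (f : hom X Y), is_epi f ->
  forall g : hom P Y, exists h : hom P X, f \oc h = g.

Definition injective_object I : Prop :=
  forall X Y (f : hom X Y), is_mono f ->
  forall g : hom X I, exists h : hom Y I, h \oc f = g.

Definition enough_projectives : Prop :=
  forall X, exists P (f : hom P X), projective P /\ is_epi f.

Definition enough_injectives : Prop :=
  forall X, exists I (f : hom X I), injective_object I /\ is_mono f.

Definition pd X : enat :=
  einf (fun n => exists (P : nat -> A) (d : forall j, hom (P j.+1) (P j))
    (a : hom (P 0) X),
    exact_resolution n d a /\ forall j, j <= n -> projective (P j)).

Definition gldim : enat := esup (fun _ : A => True) pd.

(* f and g become equal in A/[Proj A]. *)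
Definition stable_eq X Y (f g : hom X Y) : Prop :=
  exists P (u : hom X P) (v : hom P Y), projective P /\ (f - g)%R = v \oc u.

Definition stable_retract U V : Prop :=
  exists (s : hom U V) (r : hom V U), stable_eq (r \oc s) (idm U).

(* A choice, for each X, of an epimorphism P_X -> X with P_X projective and of
   its kernel syz X = Omega X. *)
Record syzygies := Syzygies {
  cover : A -> A;
  cover_map : forall X, hom (cover X) X;
  syz : A -> A;
  syz_map : forall X, hom (syz X) (cover X);
  cover_projective : forall X, projective (cover X);
  cover_epi : forall X, is_epi (cover_map X);
  syz_kernel : forall X, is_kernel (cover_map X) (syz_map X)
}.

Definition Omega (O : syzygies) (n : nat) X : A := iter n (syz O) X.

Definition dell (O : syzygies) (k : nat) X : enat :=
  einf (fun n => exists Y, stable_retract (Omega O n X) (Omega O (n + k) Y)).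

Definition ddell (O : syzygies) (k : nat) X : enat :=
  einf (fun m => exists t (C : nat -> A) (d : forall j, hom (C j.+1) (C j))
    (a : hom (C 0) X),
    [/\ t <= m, exact_resolution t d a
      & forall j, j <= t -> (dell O (j + k) (C j) <= (m - j)%:E)%en]).

Definition ddell_cat (O : syzygies) (k : nat) : enat := esup simple (ddell O k).

End Preadditive.

(* Additivity is not required: functors in an adjunction between abelian
   categories are additive. *)
Record functor (A B : preadditive) := Functor {
  fobj :> A -> B;
  fmap : forall X Y : A, hom X Y -> hom (fobj X) (fobj Y);
  fmap1 : forall X : A, fmap (idm X) = idm (fobj X);
  fmapM : forall (X Y Z : A) (g : hom Y Z) (f : hom X Y),
    fmap (g \oc f) = fmap g \oc fmap f
}.

Arguments fmap {A B} F {X Y} f : rename.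

Definition fully_faithful (A B : preadditive) (F : functor A B) : Prop :=
  forall X Y : A, bijective (fun f : hom X Y => fmap F f).

(* F is left adjoint to G. *)
Record adjunction (A B : preadditive) (F : functor A B) (G : functor B A) :=
  Adjunction {
  adj_unit : forall X : A, hom X (G (F X));
  adj_counit : forall Y : B, hom (F (G Y)) Y;
  adj_unit_nat : forall (X X' : A) (f : hom X X'),
    adj_unit X' \oc f = fmap G (fmap F f) \oc adj_unit X;
  adj_counit_nat : forall (Y Y' : B) (g : hom Y Y'),
    adj_counit Y' \oc fmap F (fmap G g) = g \oc adj_counit Y;
  adj_triangleF : forall X : A,
    adj_counit (F X) \oc fmap F (adj_unit X) = idm (F X);
  adj_triangleG : forall Y : B,
    fmap G (adj_counit Y) \oc adj_unit (G Y) = idm (G Y)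
}.

Arguments adj_unit {A B F G} a X : rename.
Arguments adj_counit {A B F G} a Y : rename.

Record recollement (A B C : preadditive) := Recollement {
  rec_i : functor A B;
  rec_q : functor B A;
  rec_p : functor B A;
  rec_e : functor B C;
  rec_l : functor C B;
  rec_r : functor C B;
  adj_qi : adjunction rec_q rec_i;
  adj_ip : adjunction rec_i rec_p;
  adj_le : adjunction rec_l rec_e;
  adj_er : adjunction rec_e rec_r;
  rec_i_ff : fully_faithful rec_i;
  rec_l_ff : fully_faithful rec_l;
  rec_r_ff : fully_faithful rec_r;
  (* The essential image of i is the kernel of e. *)
  rec_im_ker : forall X : B,
    (exists Y : A, isomorphic (rec_i Y) X) <-> is_zero (rec_e X)
}.

Definition pgldim (A B C : preadditive) (R : recollement A B C) : enat :=
  esup (fun _ : A => True) (fun X => pd (rec_i R X)).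

(* The largest length of l T with T simple in C, and 0 if C has no simple
   object. *)
Definition L_l (A B C : preadditive) (R : recollement A B C) : enat :=
  esup (@simple C) (fun T => clength (rec_l R T)).

(* Y' S is an object of A with i (Y' S) a cokernel of the unit S -> r e S, for
   each simple S of B; the values of Y' at other objects are irrelevant. *)
Definition unit_cokernels (A B C : preadditive) (R : recollement A B C)
    (Y' : B -> A) : Prop :=
  forall S : B, simple S ->
  exists c : hom (rec_r R (rec_e R S)) (rec_i R (Y' S)),
    is_cokernel (adj_unit (adj_er R) S) c.

Definition L_r (A B : preadditive) (Y' : B -> A) : enat :=
  esup (@simple B) (fun S => clength (Y' S)).

(* Main.v *)
(* If 0 -> X -> Y -> Z -> 0 is exact, rotating it to
   0 -> Omega Z -> X + P -> Y -> 0 and splicing resolutions gives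
   ddell Y <= ddell X + ddell Z + 1; by induction an object of length L has
   ddell at most L (d + 1) - 1, where d bounds ddell on the simple objects.

   Since pd i(A) <= 1, the functor e preserves projectives: the image of
   l e P -> P is a syzygy of an object of Im i, so it is projective.  As e is
   exact, ddell (e X) <= ddell X, and X = l T with T simple gives the first
   bound, because e l T = T.

   As e preserves projectives, r is exact.  The kernel and cokernel of
   l e (r P) -> r P lie in Im i, so pd (r P) <= 2 for P projective; hence
   Omega^2 r commutes stably with Omega, and r raises ddell by at most 2.  For
   a simple S with e S <> 0 the cokernel of S -> r e S has pd <= 1; pulling a
   resolution of r e S back to S costs one more step.  This gives
   ddell B <= ddell C + 3.

   For gl.dim A <= 1: with P projective in A and 0 -> K -> P -> X -> 0 exact,
   Ext^1_B(i P, i L) = Ext^1_A(P, L) = 0 and pd i(X) <= 1 force K to be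
   projective. *)

From mathcomp Require Import all_boot all_algebra boolp.
Require Import Defs.

Set Implicit Arguments.
Unset Strict Implicit.
Unset Printing Implicit Defensive.

Import GRing.Theory.
Local Open Scope ring_scope.
Local Open Scope cat_scope.

(** * Bounds on infima and suprema of extended naturals *)

Lemma einf_le (P : nat -> Prop) n :
  (einf P <= n%:E)%en <-> exists2 m, (m <= n)%N & P m.
Proof.
rewrite /einf; case: pselect => [h|nh]; last first.
  by split=> // -[m _ Pm]; case: nh; exists m.
case: ex_minnP => m0 /asboolP Pm0 m0P /=; split=> [le0|[m lemn Pm]].
  by exists m0.
by apply: leq_trans lemn; apply/m0P/asboolP.
Qed.

Lemma ele_trans (y x z : enat) : (x <= y)%en -> (y <= z)%en -> (x <= z)%en.
Proof. by case: x y z => [x|] [y|] [z|] //=; apply: leq_trans. Qed.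

Lemma esup_le (I : Type) (D : I -> Prop) (f : I -> enat) n :
  (esup D f <= n%:E)%en <-> forall x, D x -> (f x <= n%:E)%en.
Proof.
rewrite einf_le; split=> [[m lemn fm] x /fm le|fn]; last by exists n.
exact: ele_trans le _.
Qed.

(** * Abelian categories with enough projectives *)

Section PreadditiveBasics.
Variable A : preadditive.
Implicit Types X Y Z W : A.

Lemma comp0m X Y Z (f : hom X Y) : (0 : hom Y Z) \oc f = 0.
Proof. by apply: (addIr ((0 : hom Y Z) \oc f)); rewrite -compDl !add0r. Qed.

Lemma compm0 X Y Z (g : hom Y Z) : g \oc (0 : hom X Y) = 0.
Proof. by apply: (addIr (g \oc (0 : hom X Y))); rewrite -compDr !add0r. Qed.

Lemma compNm X Y Z (g : hom Y Z) (f : hom X Y) : (- g) \oc f = - (g \oc f).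
Proof. by apply: (addIr (g \oc f)); rewrite -compDl !addNr comp0m. Qed.

Lemma compmN X Y Z (g : hom Y Z) (f : hom X Y) : g \oc (- f) = - (g \oc f).
Proof. by apply: (addIr (g \oc f)); rewrite -compDr !addNr compm0. Qed.

Lemma compBl X Y Z (g g' : hom Y Z) (f : hom X Y) :
  (g - g') \oc f = g \oc f - g' \oc f.
Proof. by rewrite compDl compNm. Qed.

Lemma compBr X Y Z (g : hom Y Z) (f f' : hom X Y) :
  g \oc (f - f') = g \oc f - g \oc f'.
Proof. by rewrite compDr compmN. Qed.

Lemma mono_eq0 X Y W (f : hom X Y) (x : hom W X) :
  is_mono f -> f \oc x = 0 -> x = 0.
Proof. by move=> mf fx0; apply: mf; rewrite fx0 compm0. Qed.

Lemma epi_eq0 X Y W (f : hom X Y) (x : hom Y W) :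
  is_epi f -> x \oc f = 0 -> x = 0.
Proof. by move=> ef xf0; apply: ef; rewrite xf0 comp0m. Qed.

Lemma is_mono0 X Y (f : hom X Y) :
  (forall W (x : hom W X), f \oc x = 0 -> x = 0) -> is_mono f.
Proof.
by move=> f0 W g h fgh; apply/subr0_eq/f0; rewrite compBr fgh subrr.
Qed.

Lemma is_epi0 X Y (f : hom X Y) :
  (forall W (x : hom Y W), x \oc f = 0 -> x = 0) -> is_epi f.
Proof.
by move=> f0 W g h fgh; apply/subr0_eq/f0; rewrite compBl fgh subrr.
Qed.

Lemma mono_comp X Y Z (g : hom Y Z) (f : hom X Y) :
  is_mono g -> is_mono f -> is_mono (g \oc f).
Proof. by move=> mg mf W x y; rewrite -!compA => /mg /mf. Qed.

Lemma epi_comp X Y Z (g : hom Y Z) (f : hom X Y) :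
  is_epi g -> is_epi f -> is_epi (g \oc f).
Proof. by move=> eg ef W x y; rewrite !compA => /ef /eg. Qed.

Lemma mono_cancel X Y Z (g : hom Y Z) (f : hom X Y) :
  is_mono (g \oc f) -> is_mono f.
Proof. by move=> m W x y e; apply: m; rewrite -!compA e. Qed.

Lemma epi_cancel X Y Z (g : hom Y Z) (f : hom X Y) :
  is_epi (g \oc f) -> is_epi g.
Proof. by move=> m W x y e; apply: m; rewrite !compA e. Qed.

Lemma split_epi X Y (f : hom X Y) (s : hom Y X) : f \oc s = idm Y -> is_epi f.
Proof.
by move=> fs W x y e; rewrite -[x]compm1 -[y]compm1 -fs !compA e.
Qed.

Lemma split_mono X Y (f : hom X Y) (r : hom Y X) : r \oc f = idm X -> is_mono f.
Proof.
by move=> rf W x y e; rewrite -[x]comp1m -[y]comp1m -rf -!compA e.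
Qed.

Lemma iso_id X : is_iso (idm X).
Proof. by exists (idm X); rewrite comp1m. Qed.

Lemma iso_mono X Y (f : hom X Y) : is_iso f -> is_mono f.
Proof. by case=> g [/split_mono]. Qed.

Lemma iso_epi X Y (f : hom X Y) : is_iso f -> is_epi f.
Proof. by case=> g [_ /split_epi]. Qed.

Lemma isomorphic_sym X Y : isomorphic X Y -> isomorphic Y X.
Proof. by move=> [f [g [gf fg]]]; exists g, f. Qed.

Lemma is_zero_id X : idm X = 0 -> is_zero X.
Proof.
move=> id0 Y; split=> f; first by rewrite -[f]compm1 id0 compm0.
by rewrite -[f]comp1m id0 comp0m.
Qed.

Lemma zero_from X Y (f : hom X Y) : is_zero X -> f = 0.
Proof. by move=> /(_ Y) []. Qed.

Lemma zero_to X Y (f : hom X Y) : is_zero Y -> f = 0.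
Proof. by move=> /(_ X) []. Qed.

Lemma epi0_zero X Y (f : hom X Y) : is_epi f -> f = 0 -> is_zero Y.
Proof. by move=> ef f0; apply/is_zero_id/(epi_eq0 ef); rewrite f0 compm0. Qed.

Lemma mono0_zero X Y (f : hom X Y) : is_mono f -> f = 0 -> is_zero X.
Proof. by move=> mf f0; apply/is_zero_id/(mono_eq0 mf); rewrite f0 comp0m. Qed.

Lemma isomorphic_zero X Y : isomorphic X Y -> is_zero X -> is_zero Y.
Proof. by move=> [f /iso_epi ef] zX; apply: epi0_zero ef (zero_from _ zX). Qed.

Lemma to_zero_epi X Z (f : hom X Z) : is_zero Z -> is_epi f.
Proof. by move=> zZ W x y _; rewrite (zero_from x zZ) (zero_from y zZ). Qed.

Lemma from_zero_mono X Z (f : hom Z X) : is_zero Z -> is_mono f.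
Proof. by move=> zZ W x y _; rewrite (zero_to x zZ) (zero_to y zZ). Qed.

Lemma zero_projective Z : is_zero Z -> projective Z.
Proof. by move=> zZ X Y f _ g; exists 0; rewrite compm0 (zero_from g zZ). Qed.

(** * Kernels, cokernels and short exact sequences *)

Lemma ker0 X Y (f : hom X Y) K (k : hom K X) : is_kernel f k -> f \oc k = 0.
Proof. by case. Qed.

Lemma ker_lift X Y (f : hom X Y) K (k : hom K X) W (h : hom W X) :
  is_kernel f k -> f \oc h = 0 -> exists u, k \oc u = h.
Proof. by move=> [_ kP] /kP[u [ku _]]; exists u. Qed.

Lemma ker_mono X Y (f : hom X Y) K (k : hom K X) : is_kernel f k -> is_mono k.
Proof.
move=> [fk0 kP] W g h e.
have /kP[u [_ uU]] : f \oc (k \oc g) = 0 by rewrite compA fk0 comp0m.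
by rewrite -(uU g erefl) -(uU h (esym e)).
Qed.

Lemma is_ker X Y (f : hom X Y) K (k : hom K X) :
    f \oc k = 0 -> is_mono k ->
    (forall W (h : hom W X), f \oc h = 0 -> exists u, k \oc u = h) ->
  is_kernel f k.
Proof.
move=> fk0 mk kP; split=> // W h /kP[u ku]; exists u; split=> // u' ku'.
by apply: mk; rewrite ku.
Qed.

Lemma coker_desc X Y (f : hom X Y) Q (q : hom Y Q) W (h : hom Y W) :
  is_cokernel f q -> h \oc f = 0 -> exists u, u \oc q = h.
Proof. by move=> [_ qP] /qP[u [uq _]]; exists u. Qed.

Lemma coker_epi X Y (f : hom X Y) Q (q : hom Y Q) : is_cokernel f q -> is_epi q.
Proof.
move=> [qf0 qP] W g h e.
have /qP[u [_ uU]] : g \oc q \oc f = 0 by rewrite -compA qf0 compm0.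
by rewrite -(uU g erefl) -(uU h (esym e)).
Qed.

Lemma is_coker X Y (f : hom X Y) Q (q : hom Y Q) :
    q \oc f = 0 -> is_epi q ->
    (forall W (h : hom Y W), h \oc f = 0 -> exists u, u \oc q = h) ->
  is_cokernel f q.
Proof.
move=> qf0 eq qP; split=> // W h /qP[u uq]; exists u; split=> // u' uq'.
by apply: eq; rewrite uq.
Qed.

Lemma ker_zero_mono X Y (f : hom X Y) K (k : hom K X) :
  is_kernel f k -> is_zero K -> is_mono f.
Proof.
move=> kk zK; apply: is_mono0 => W x /(ker_lift kk)[u <-].
by rewrite (zero_to u zK) compm0.
Qed.

(** A kernel paired with an epimorphism gives factorisations directly; in an abelian category this
    agrees with [short_exact], by [ses_short_exact]. *)
Definition ses X Y Z (f : hom X Y) (g : hom Y Z) : Prop :=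
  is_kernel g f /\ is_epi g.

Lemma ses_iso_r X Y Z Z' (f : hom X Y) (g : hom Y Z) (h : hom Z Z') :
  is_iso h -> ses f g -> ses f (h \oc g).
Proof.
move=> ih [kf eg]; split; last exact: epi_comp (iso_epi ih) eg.
apply: is_ker; first by rewrite -compA (ker0 kf) compm0.
  exact: ker_mono kf.
move=> W x; rewrite -compA => /(mono_eq0 (iso_mono ih)); exact: ker_lift.
Qed.

Lemma biproduct_projective X Y S i1 i2 p1 p2 :
  @is_biproduct A X Y S i1 i2 p1 p2 -> projective X -> projective Y ->
  projective S.
Proof.
move=> [_ _ _ _ e] pX pY U V f ef g.
have [x fx] := pX _ _ _ ef (g \oc i1); have [y fy] := pY _ _ _ ef (g \oc i2).
exists (x \oc p1 + y \oc p2).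
by rewrite compDr !compA fx fy -!compA -compDr e compm1.
Qed.

End PreadditiveBasics.

Section Abelian.
Variable A : preadditive.
Hypothesis abA : is_abelian A.
Implicit Types X Y Z W : A.

Lemma zero_ex : exists Z : A, is_zero Z.
Proof. by case: abA. Qed.

Lemma biproduct_ex X Y : exists S (i1 : hom X S) (i2 : hom Y S)
  (p1 : hom S X) (p2 : hom S Y), is_biproduct i1 i2 p1 p2.
Proof. by case: abA => _ []. Qed.

Lemma kernel_ex X Y (f : hom X Y) : exists K (k : hom K X), is_kernel f k.
Proof. by case: abA => _ [_ []]. Qed.

Lemma cokernel_ex X Y (f : hom X Y) : exists Q (q : hom Y Q), is_cokernel f q.
Proof. by case: abA => _ [_ [_ []]]. Qed.

Lemma mono_is_kernel X Y (f : hom X Y) :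
  is_mono f -> exists Z (g : hom Y Z), is_kernel g f.
Proof. by case: abA => _ [_ [_ [_ []]]] + _; apply. Qed.

Lemma epi_is_cokernel X Y (f : hom X Y) :
  is_epi f -> exists Z (g : hom Z X), is_cokernel g f.
Proof. by case: abA => _ [_ [_ [_ []]]] _; apply. Qed.

Lemma epi_coker_ker X Y (f : hom X Y) K (k : hom K X) :
  is_epi f -> is_kernel f k -> is_cokernel k f.
Proof.
move=> ef kk; apply: is_coker => //; first exact: ker0 kk.
have [Z [g cg]] := epi_is_cokernel ef; case: (cg) => fg0 _.
have [u ku] := ker_lift kk fg0; move=> W h hk0.
by apply: coker_desc cg _; rewrite -ku compA hk0 comp0m.
Qed.

Lemma mono_ker_coker X Y (f : hom X Y) Q (q : hom Y Q) :
  is_mono f -> is_cokernel f q -> is_kernel q f.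
Proof.
move=> mf cq; apply: is_ker => //; first by case: cq.
have [Z [g kg]] := mono_is_kernel mf.
have [u uq] := coker_desc cq (ker0 kg); move=> W h qh0.
by apply: ker_lift kg _; rewrite -uq -compA qh0 compm0.
Qed.

Lemma mono_epi_iso X Y (f : hom X Y) : is_mono f -> is_epi f -> is_iso f.
Proof.
move=> mf ef; have [Z [g kg]] := mono_is_kernel mf.
have g0 : g = 0 by apply: epi_eq0 ef (ker0 kg).
have [s fs] : exists s, f \oc s = idm Y.
  by apply: ker_lift kg _; rewrite g0 comp0m.
by exists s; split=> //; apply: mf; rewrite compA fs comp1m compm1.
Qed.

(** The image is the kernel of the cokernel. *)
Lemma image_ex X Y (f : hom X Y) : exists I (u : hom X I) (m : hom I Y),
  [/\ is_epi u, is_mono m & f = m \oc u].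
Proof.
have [Q [q cq]] := cokernel_ex f; have [I [m km]] := kernel_ex q.
have [u mu] := ker_lift km cq.1; exists I, u, m; split; last by [].
  apply: is_epi0 => W h hu0; have [K [k kk]] := kernel_ex h.
  have [u' ku'] := ker_lift kk hu0.
  (* Here [f] factors through [m \oc k], the kernel of [c]. As [c] kills [f] it kills [m], so [k]
     has a section and [h] is zero. *)
  have [Z [c kc]] := mono_is_kernel (mono_comp (ker_mono km) (ker_mono kk)).
  have cf0 : c \oc f = 0.
    by rewrite -mu -ku' !compA -(compA c) (ker0 kc) comp0m.
  have [c' c'q] := coker_desc cq cf0.
  have cm0 : c \oc m = 0 by rewrite -c'q -compA (ker0 km) compm0.
  have [s mks] := ker_lift kc cm0.
  have ks : k \oc s = idm I.
    by apply: (ker_mono km); rewrite compA mks compm1.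
  by rewrite -[h]compm1 -ks compA (ker0 kk) comp0m.
exact: ker_mono km.
Qed.

Lemma ses_short_exact X Y Z (f : hom X Y) (g : hom Y Z) :
  short_exact f g <-> ses f g.
Proof.
split=> [[mf [K [k [u [kk eu fku]]]] eg]|[kf eg]].
  split=> //.
  have [v [vu uv]] : is_iso u.
    by apply: mono_epi_iso => //; apply: (@mono_cancel _ _ _ _ k); rewrite -fku.
  apply: is_ker => //; first by rewrite fku compA (ker0 kk) comp0m.
  move=> W h /(ker_lift kk)[w kw]; exists (v \oc w).
  by rewrite fku -compA (compA u) uv comp1m.
split=> //; first exact: ker_mono kf.
exists X, f, (idm X); split=> //; last by rewrite compm1.
by move=> W x y; rewrite !compm1.
Qed.

Lemma ses_of_epi X Y (f : hom X Y) :
  is_epi f -> exists K (k : hom K X), ses k f.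
Proof. by move=> ef; have [K [k kk]] := kernel_ex f; exists K, k. Qed.

Lemma ses_of_mono X Y (f : hom X Y) : is_mono f ->
  exists Q (q : hom Y Q), ses f q.
Proof.
move=> mf; have [Q [q cq]] := cokernel_ex f; exists Q, q.
by split; [apply: mono_ker_coker|apply: coker_epi cq].
Qed.

Lemma ses_coker X Y Z (f : hom X Y) (g : hom Y Z) : ses f g -> is_cokernel f g.
Proof. by move=> [kf eg]; apply: epi_coker_ker. Qed.

Lemma ses_zero_iso X Y Z (f : hom X Y) (g : hom Y Z) :
  ses f g -> is_zero X -> is_iso g.
Proof.
by move=> [kf eg] zX; apply: mono_epi_iso => //; apply: ker_zero_mono kf _.
Qed.

(** * Diagram lemmas tested on projectives *)

Hypothesis projA : enough_projectives A.

(** Projectives stand in for elements: an epimorphism from a projective onto [Y] factors through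
    [f]. *)
Lemma epi_by_projectives X Y (f : hom X Y) :
  (forall P (y : hom P Y), projective P -> exists x, f \oc x = y) -> is_epi f.
Proof.
move=> fP; have [P [y [pP ey]]] := projA Y.
by have [x fx] := fP P y pP; apply: (@epi_cancel _ _ _ _ _ x); rewrite fx.
Qed.

(** A lift found on a projective mapping onto [W] by [t] kills the kernel of [t], because [f] is
    mono, and so descends to [W]. *)
Lemma kernel_by_projectives X Y Z (f : hom X Y) (g : hom Y Z) :
    g \oc f = 0 -> is_mono f ->
    (forall P (y : hom P Y), projective P -> g \oc y = 0 ->
       exists x, f \oc x = y) ->
  is_kernel g f.
Proof.
move=> gf0 mf fP; apply: is_ker => // W h gh0.
have [P [t [pP et]]] := projA W.
have [x fx] : exists x, f \oc x = h \oc t.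
  by apply: fP; rewrite // compA gh0 comp0m.
have [K [k st]] := ses_of_epi et.
have [u ut] : exists u, u \oc t = x.
  apply: coker_desc (ses_coker st) _; apply: (mono_eq0 mf).
  by rewrite compA fx -compA (ker0 st.1) compm0.
by exists u; apply: et; rewrite -compA ut.
Qed.

(** [C'] is the pullback of [b] along [f], realised as the kernel of [g \oc b]. *)
Lemma ses_comp_kernel X' C Y X Z (a : hom X' C) (b : hom C Y)
    (f : hom X Y) (g : hom Y Z) :
    ses a b -> ses f g ->
  exists C' (m : hom C' C) (a' : hom X' C') (b' : hom C' X),
    [/\ ses m (g \oc b), ses a' b', m \oc a' = a & f \oc b' = b \oc m].
Proof.
move=> [ka eb] [kf eg].
have [C' [m sm]] := ses_of_epi (epi_comp eg eb).
have [a' ma'] : exists a', m \oc a' = a.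
  by apply: ker_lift sm.1 _; rewrite -compA (ker0 ka) compm0.
have [b' fb'] : exists b', f \oc b' = b \oc m.
  by apply: ker_lift kf _; rewrite compA (ker0 sm.1).
exists C', m, a', b'; split=> //; split.
  apply: is_ker.
  - by apply: (mono_eq0 (ker_mono kf)); rewrite compA fb' -compA ma' (ker0 ka).
  - by apply: (@mono_cancel _ _ _ _ m); rewrite ma'; apply: ker_mono ka.
  move=> W h b'h0; have [x ax] : exists x, a \oc x = m \oc h.
    by apply: ker_lift ka _; rewrite compA -fb' -compA b'h0 compm0.
  by exists x; apply: (ker_mono sm.1); rewrite compA ma'.
apply: epi_by_projectives => P y pP.
have [c bc] := pP _ _ _ eb (f \oc y).
have [c' mc'] : exists c', m \oc c' = c.
  by apply: ker_lift sm.1 _; rewrite -compA bc compA (ker0 kf) comp0m.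
by exists c'; apply: (ker_mono kf); rewrite compA fb' -compA mc'.
Qed.

(** [C] is an arbitrary object over [X], so the same lemma passes to syzygies, rotates a short exact
    sequence and splices resolutions. *)
Lemma horseshoe X Y Z X' C Z' P (f : hom X Y) (g : hom Y Z)
    (a : hom X' C) (c : hom C X) (k : hom Z' P) (p : hom P Z) :
    ses f g -> ses a c -> ses k p -> projective P ->
  exists S (i1 : hom C S) (i2 : hom P S) (p1 : hom S C) (p2 : hom S P)
      V (v : hom V S) (s : hom S Y) (a' : hom X' V) (w : hom V Z'),
    [/\ is_biproduct i1 i2 p1 p2, ses v s & ses a' w].
Proof.
move=> [kf eg] [ka ec] [kk ep] pP.
have [y gy] := pP _ _ _ eg p.
have [S [i1 [i2 [p1 [p2 bS]]]]] := biproduct_ex C P.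
case: (bS) => e11 e22 e12 e21 eS.
pose s := f \oc c \oc p1 + y \oc p2.
have gs : g \oc s = p \oc p2.
  by rewrite compDr !compA (ker0 kf) !comp0m add0r gy.
have s1 : s \oc i1 = f \oc c.
  by rewrite compDl -!compA e11 e21 compm0 addr0 compm1.
have s2 : s \oc i2 = y.
  by rewrite compDl -!compA e12 e22 !compm0 add0r compm1.
have es : is_epi s.
  apply: epi_by_projectives => T t pT.
  have [z pz] := pT _ _ _ ep (g \oc t).
  have [x fx] : exists x, f \oc x = t - y \oc z.
    by apply: ker_lift kf _; rewrite compBr compA gy pz subrr.
  have [x' cx'] := pT _ _ _ ec x.
  exists (i1 \oc x' + i2 \oc z).
  by rewrite compDr !compA s1 s2 -compA cx' fx subrK.
have [V [v sv]] := ses_of_epi es.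
have [w kw] : exists w, k \oc w = p2 \oc v.
  by apply: ker_lift kk _; rewrite compA -gs -compA (ker0 sv.1) compm0.
have [a' va'] : exists a', v \oc a' = i1 \oc a.
  by apply: ker_lift sv.1 _; rewrite compA s1 -compA (ker0 ka) compm0.
exists S, i1, i2, p1, p2, V, v, s, a', w; split=> //; split.
  apply: is_ker.
  - apply: (mono_eq0 (ker_mono kk)).
    by rewrite compA kw -compA va' compA e21 comp0m.
  - apply: (@mono_cancel _ _ _ _ v); rewrite va'.
    exact: mono_comp (split_mono e11) (ker_mono ka).
  move=> W h wh0.
  have p2h : p2 \oc (v \oc h) = 0 by rewrite compA -kw -compA wh0 compm0.
  have vh : v \oc h = i1 \oc (p1 \oc (v \oc h)).
    by rewrite -{1}[v \oc h]comp1m -eS compDl -!compA p2h compm0 addr0.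
  have [x ax] : exists x, a \oc x = p1 \oc (v \oc h).
    apply: ker_lift ka _; apply: (mono_eq0 (ker_mono kf)).
    by rewrite compA -s1 -compA -vh compA (ker0 sv.1) comp0m.
  by exists x; apply: (ker_mono sv.1); rewrite compA va' -compA ax.
apply: epi_by_projectives => T z pT.
(* The image of [z] in [Y] comes from [X]; lifting it to [C] and subtracting gives an element of [V]
   over [z]. *)
have [x fx] : exists x, f \oc x = y \oc (k \oc z).
  by apply: ker_lift kf _; rewrite !compA gy (ker0 kk) comp0m.
have [x' cx'] := pT _ _ _ ec x.
have [h vh] : exists h, v \oc h = i2 \oc (k \oc z) - i1 \oc x'.
  apply: ker_lift sv.1 _.
  by rewrite compBr !compA s1 s2 -(compA f) cx' fx compA subrr.
exists h; apply: (ker_mono kk).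
by rewrite compA kw -compA vh compBr !compA e22 e21 comp0m comp1m subr0.
Qed.

(** * Syzygies and delooping levels *)

(** A relation instead of the chosen operator [syz], so that any projective presentation may be
    used; two choices are stable retracts of each other by [nth_syzygy_retract]. *)
Definition syzygy U X : Prop :=
  exists P (k : hom U P) (p : hom P X), projective P /\ ses k p.

Fixpoint nth_syzygy n X U : Prop :=
  if n is n'.+1 then exists2 V, nth_syzygy n' X V & syzygy U V else U = X.

Fixpoint pd_le n X : Prop :=
  if n is n'.+1 then exists2 U, syzygy U X & pd_le n' U else projective X.

(* For n = 0 these are the stable retracts. *)
Definition retract_mod n U V : Prop :=
  exists X (s : hom U V) (r : hom V U) (u : hom U X) (v : hom X U),
    pd_le n X /\ r \oc s + v \oc u = idm U.

Lemma syzygy_ex X : exists U, syzygy U X.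
Proof.
have [P [p [pP ep]]] := projA X; have [U [k sk]] := ses_of_epi ep.
by exists U, P, k, p.
Qed.

Lemma nth_syzygy_ex n X : exists U, nth_syzygy n X U.
Proof.
elim: n => [|n [V nV]]; first by exists X.
by have [U sU] := syzygy_ex V; exists U, V.
Qed.

Lemma nth_syzygy_add m n X V U :
  nth_syzygy n X V -> nth_syzygy m V U -> nth_syzygy (m + n) X U.
Proof.
move=> nV; elim: m U => [|m IH] U /=; first by move=> ->.
by move=> [W /IH nW sU]; exists W.
Qed.

Lemma nth_syzygyS n X V U :
  syzygy V X -> nth_syzygy n V U -> nth_syzygy n.+1 X U.
Proof.
by move=> sV nU; rewrite -addn1; apply: nth_syzygy_add nU; exists X.
Qed.

Lemma ses_zero_id Z X : is_zero Z -> ses (0 : hom Z X) (idm X).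
Proof.
move=> zZ; split; last exact/iso_epi/iso_id.
apply: is_ker; [by rewrite compm0|exact: from_zero_mono|].
by move=> W h; rewrite comp1m => ->; exists 0; rewrite comp0m.
Qed.

Lemma biproduct_ses X Y S i1 i2 p1 p2 :
  @is_biproduct A X Y S i1 i2 p1 p2 -> ses i1 p2.
Proof.
move=> [e11 e22 e12 e21 eS]; split; last exact: split_epi e22.
apply: is_ker => //; first exact: split_mono e11.
move=> W h ph0; exists (p1 \oc h).
by rewrite -{2}[h]comp1m -eS compDl -!compA ph0 compm0 addr0.
Qed.

Lemma biproduct_comp X Y S i1 i2 p1 p2 U V (u1 : hom U X) (u2 : hom U Y)
    (v1 : hom X V) (v2 : hom Y V) :
  @is_biproduct A X Y S i1 i2 p1 p2 ->
  (v1 \oc p1 + v2 \oc p2) \oc (i1 \oc u1 + i2 \oc u2) = v1 \oc u1 + v2 \oc u2.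
Proof.
move=> [e11 e22 e12 e21 _].
rewrite !compDl !compDr -!compA !(compA p1) !(compA p2) e11 e22 e12 e21.
by rewrite !comp0m !comp1m !compm0 addr0 add0r.
Qed.

Lemma ses_split X Y Z (f : hom X Y) (g : hom Y Z) : ses f g -> projective Z ->
  exists (t : hom Z Y) (r : hom Y X),
    [/\ g \oc t = idm Z, r \oc f = idm X & f \oc r + t \oc g = idm Y].
Proof.
move=> [kf eg] pZ; have [t gt] := pZ _ _ _ eg (idm Z).
have [r fr] : exists r, f \oc r = idm Y - t \oc g.
  by apply: ker_lift kf _; rewrite compBr compm1 compA gt comp1m subrr.
exists t, r; split=> //; last by rewrite fr subrK.
apply: (ker_mono kf); rewrite compA fr compBl -compA (ker0 kf) compm0 subr0.
by rewrite comp1m compm1.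
Qed.

(** The sequence splits when [n] is zero; otherwise the horseshoe lemma passes to syzygies. *)
Lemma pd_le_ses n X Y Z (f : hom X Y) (g : hom Y Z) :
  ses f g -> pd_le n X -> pd_le n Z -> pd_le n Y.
Proof.
elim: n X Y Z f g => [|n IH] X Y Z f g sfg /=.
  move=> pX pZ; have [t [r [gt rf e]]] := ses_split sfg pZ.
  move=> U V h eh y.
  have [a ha] := pX _ _ _ eh (y \oc f); have [b hb] := pZ _ _ _ eh (y \oc t).
  exists (a \oc r + b \oc g).
  by rewrite compDr !compA ha hb -!compA -compDr e compm1.
move=> [X' [C [a [c [pC sX]]]] pX'] [Z' [P [k [p [pP sZ]]]] pZ'].
have [S [i1 [i2 [p1 [p2 [V [v [s [a' [w [bS sY sV]]]]]]]]]]] :=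
  horseshoe sfg sX sZ pP.
exists V; last exact: IH sV pX' pZ'.
by exists S, v, s; split=> //; apply: biproduct_projective bS pC pP.
Qed.

Lemma pd_le_zero n Z : is_zero Z -> pd_le n Z.
Proof.
move=> zZ; elim: n => [|n IH] /=; first exact: zero_projective.
exists Z => //; exists Z, 0, (idm Z).
by split; [apply: zero_projective|apply: ses_zero_id].
Qed.

Lemma pd_leS n X : pd_le n X -> pd_le n.+1 X.
Proof.
elim: n X => [|n IH] X; last by move=> [U sU /IH pU]; exists U.
move=> pX; have [Z zZ] := zero_ex; exists Z; last exact: zero_projective.
by exists X, 0, (idm X); split=> //; apply: ses_zero_id.
Qed.

Lemma retract_mod_split n U V (s : hom U V) (r : hom V U) :
  r \oc s = idm U -> retract_mod n U V.
Proof.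
move=> rs; have [Z zZ] := zero_ex; exists Z, s, r, 0, 0.
by rewrite compm0 addr0; split=> //; apply: pd_le_zero.
Qed.

Lemma retract_mod_refl n U : retract_mod n U U.
Proof.
by apply: (@retract_mod_split _ _ _ (idm U) (idm U)); rewrite comp1m.
Qed.

(** Composing the identities leaves the error [r \oc v' \oc u' \oc s + v \oc u], which factors
    through the biproduct of [X'] and [X]. *)
Lemma retract_mod_trans n U V W :
  retract_mod n U V -> retract_mod n V W -> retract_mod n U W.
Proof.
move=> [X [s [r [u [v [pX e]]]]]] [X' [s' [r' [u' [v' [pX' e']]]]]].
have [S [i1 [i2 [p1 [p2 bS]]]]] := biproduct_ex X' X.
exists S, (s' \oc s), (r \oc r'), (i1 \oc (u' \oc s) + i2 \oc u).
exists (r \oc v' \oc p1 + v \oc p2).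
split; first exact: pd_le_ses (biproduct_ses bS) pX' pX.
rewrite (biproduct_comp _ _ _ _ bS) -e addrA; congr (_ + _).
by rewrite -[X in _ = r \oc X]comp1m -e' compDl compDr !compA.
Qed.

Lemma ses_lift K P X K' Y Z (k : hom K P) (p : hom P X) (k' : hom K' Y)
    (q : hom Y Z) (h : hom X Z) :
    ses k p -> ses k' q -> projective P ->
  exists (h0 : hom P Y) (h1 : hom K K'),
    q \oc h0 = h \oc p /\ k' \oc h1 = h0 \oc k.
Proof.
move=> [kk _] [kk' eq] pP; have [h0 e0] := pP _ _ _ eq (h \oc p).
have [h1 e1] : exists h1, k' \oc h1 = h0 \oc k.
  by apply: ker_lift kk' _; rewrite compA e0 -compA (ker0 kk) compm0.
by exists h0, h1.
Qed.

(** A syzygy lowers the projective dimension of the error object by one. On [P] the lifted maps add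
    up to the identity only up to some [k \oc w]; on [U'] this contributes [w \oc k], an extra error
    through the projective [P]. *)
Lemma retract_mod_syzygy n U V U' V' : retract_mod n.+1 U V ->
  syzygy U' U -> syzygy V' V -> retract_mod n U' V'.
Proof.
move=> [X [s [r [u [v [[X' [Q [kq [q [pQ sX]]]] pX'] e]]]]]].
move=> [P [k [p [pP sU]]]] [P' [k' [p' [pP' sV]]]].
have [s0 [s1 [es0 es1]]] := ses_lift s sU sV pP.
have [r0 [r1 [er0 er1]]] := ses_lift r sV sU pP'.
have [u0 [u1 [eu0 eu1]]] := ses_lift u sU sX pP.
have [v0 [v1 [ev0 ev1]]] := ses_lift v sX sU pQ.
have [w kw] : exists w, k \oc w = idm P - (r0 \oc s0 + v0 \oc u0).
  apply: ker_lift sU.1 _; rewrite compBr compDr !compA er0 ev0 -!compA es0 eu0.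
  by rewrite !compA -compDl e comp1m compm1 subrr.
have [S [i1 [i2 [p1 [p2 bS]]]]] := biproduct_ex X' P.
exists S, s1, r1, (i1 \oc u1 + i2 \oc k), (v1 \oc p1 + w \oc p2).
have pP_n : pd_le n P by elim: (n) => [|m IH] //; apply: pd_leS.
split; first exact: pd_le_ses (biproduct_ses bS) pX' pP_n.
rewrite (biproduct_comp _ _ _ _ bS); apply: (ker_mono sU.1).
rewrite !compDr !compA er1 ev1 kw -!compA es1 eu1 compBl compDl comp1m compm1.
by rewrite addrA !compA addrCA subrr addr0.
Qed.

Lemma retract0_syzygy U V U' V' : retract_mod 0 U V ->
  syzygy U' U -> syzygy V' V -> retract_mod 0 U' V'.
Proof.
move=> [X [s [r [u [v [pX e]]]]]]; apply: retract_mod_syzygy.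
by exists X, s, r, u, v; split=> //; apply: pd_leS.
Qed.

Lemma retract0_nth_syzygy n U V U' V' : retract_mod 0 U V ->
  nth_syzygy n U U' -> nth_syzygy n V V' -> retract_mod 0 U' V'.
Proof.
move=> rUV; elim: n U' V' => [|n IH] U' V' /=; first by move=> -> ->.
move=> [U1 nU sU] [V1 nV sV]; exact: retract0_syzygy (IH _ _ nU nV) sU sV.
Qed.

Lemma nth_syzygy_retract n X U V :
  nth_syzygy n X U -> nth_syzygy n X V -> retract_mod 0 U V.
Proof. exact/retract0_nth_syzygy/retract_mod_refl. Qed.

Lemma retract_mod_nth_syzygy n U V U' V' : retract_mod n U V ->
  nth_syzygy n U U' -> nth_syzygy n V V' -> retract_mod 0 U' V'.
Proof.
move=> rUV.
(* Induction on the number [m] of syzygies taken, the error object having projective dimension at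
   most [n - m]. *)
suff H m : (m <= n)%N -> forall U' V', nth_syzygy m U U' ->
    nth_syzygy m V V' -> retract_mod (n - m) U' V'.
  by move=> nU nV; rewrite -(subnn n); apply: (H n).
elim: m => [_ U1 V1 -> ->|m IH ltmn U1 V1 [U2 nU sU] [V2 nV sV]].
  by rewrite subn0.
apply: retract_mod_syzygy sU sV; rewrite -subSn // subSS.
by apply: IH => //; apply: ltnW.
Qed.

Lemma retract0_pd_le n U V : retract_mod 0 U V -> pd_le n V -> pd_le n U.
Proof.
elim: n U V => [|n IH] U V rUV /=.
  move: rUV => [X [s [r [u [v [pX e]]]]]] pV Y Z f ef g.
  have [a fa] := pV _ _ _ ef (g \oc r); have [b fb] := pX _ _ _ ef (g \oc v).
  exists (a \oc s + b \oc u).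
  by rewrite compDr !compA fa fb -!compA -compDr e compm1.
move=> [V' sV pV]; have [U' sU] := syzygy_ex U.
by exists U' => //; apply: IH pV; apply: retract0_syzygy sU sV.
Qed.

Lemma pd_le_syzygy n X U : pd_le n.+1 X -> syzygy U X -> pd_le n U.
Proof.
move=> [V sV pV] sU; apply: retract0_pd_le pV.
exact: retract0_syzygy (retract_mod_refl 0 X) sU sV.
Qed.

(** The horseshoe lemma passes to syzygies of all three terms, until the middle one is projective
    and the left one is itself a syzygy of the right one. *)
Lemma ses_nth_syzygy n X Y Z W W' (f : hom X Y) (g : hom Y Z) :
    ses f g -> pd_le n Y -> nth_syzygy n X W -> nth_syzygy n.+1 Z W' ->
  retract_mod 0 W W' /\ retract_mod 0 W' W.
Proof.
elim: n X Y Z W W' f g => [|n IH] X Y Z W W' f g sfg pY.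
  move=> -> [V -> sW']; have sX : syzygy X Z by exists Y, f, g.
  have rZ := retract_mod_refl 0 Z.
  by split; [apply: retract0_syzygy rZ sX sW'|apply: retract0_syzygy rZ sW' sX].
move=> nW nW'.
have [C [c [pC ec]]] := projA X; have [X1 [a sX]] := ses_of_epi ec.
have [P [p [pP ep]]] := projA Z; have [Z1 [k sZ]] := ses_of_epi ep.
have [S [i1 [i2 [p1 [p2 [V [v [s [a' [w [bS sY sV]]]]]]]]]]] :=
  horseshoe sfg sX sZ pP.
have pV : pd_le n V.
  apply: pd_le_syzygy pY _; exists S, v, s; split=> //.
  exact: biproduct_projective bS pC pP.
have [W1 nW1] := nth_syzygy_ex n X1; have [W2 nW2] := nth_syzygy_ex n.+1 Z1.
have [r12 r21] := IH _ _ _ _ _ _ _ sV pV nW1 nW2.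
have nX1 : nth_syzygy n.+1 X W1.
  by apply: nth_syzygyS nW1; exists C, a, c.
have nZ2 : nth_syzygy n.+2 Z W2.
  by apply: nth_syzygyS nW2; exists P, k, p.
split.
  apply: retract_mod_trans (nth_syzygy_retract nW nX1) _.
  exact: retract_mod_trans r12 (nth_syzygy_retract nZ2 nW').
apply: retract_mod_trans (nth_syzygy_retract nW' nZ2) _.
exact: retract_mod_trans r21 (nth_syzygy_retract nX1 nW).
Qed.

Lemma pd_le_nth_syzygy n X U : pd_le n X -> nth_syzygy n X U -> projective U.
Proof.
move=> pX nU; have [V nV pV] : exists2 V, nth_syzygy n X V & projective V.
  elim: n X pX {nU} => [|n IH] X /=; first by exists X.
  by move=> [Y sY /IH[V nV pV]]; exists V => //; apply: nth_syzygyS sY nV.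
exact: (@retract0_pd_le 0) (nth_syzygy_retract nU nV) pV.
Qed.

(** * Delooping levels and derived delooping levels *)

Definition dell_le k n X : Prop :=
  exists U V Y,
    [/\ nth_syzygy n X U, nth_syzygy (n + k) Y V & retract_mod 0 U V].

(* The resolutions of length at most m in the definition of ddell, cut into
   short exact sequences. *)
Fixpoint ddell_le m k X : Prop :=
  dell_le k m X \/
  if m is m'.+1 then
    exists C Y (f : hom Y C) (g : hom C X),
      [/\ ses f g, dell_le k m C & ddell_le m' k.+1 Y]
  else False.

Lemma ddell_le_dell m k X : dell_le k m X -> ddell_le m k X.
Proof. by case: m => [|m]; left. Qed.

(** One more syzygy on both sides preserves a stable retract, so the condition at the index [n]
    alone already says that the level is at most [n]. *)
Lemma dell_leW n m k X : (n <= m)%N -> dell_le k n X -> dell_le k m X.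
Proof.
move=> /subnK <-; elim: (m - n)%N => // d IH /IH[U [V [Y [nU nV rUV]]]].
have [U' sU] := syzygy_ex U; have [V' sV] := syzygy_ex V.
exists U', V', Y; split; [by exists U|by exists V|].
exact: retract0_syzygy rUV sU sV.
Qed.

Lemma dell_le_retract n k X X' :
  retract_mod 0 X X' -> dell_le k n X' -> dell_le k n X.
Proof.
move=> rX [U' [V [Y [nU' nV rUV]]]]; have [U nU] := nth_syzygy_ex n X.
exists U, V, Y; split=> //; apply: retract_mod_trans _ rUV.
exact: retract0_nth_syzygy rX nU nU'.
Qed.

(** The [n]-th syzygy of [X'] is stably a syzygy of the [n]-th syzygy of [X], hence a retract of an
    [(n + k).+1]-th syzygy. *)
Lemma dell_le_syzygy n k X X' :
  dell_le k n X -> syzygy X' X -> dell_le k.+1 n X'.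
Proof.
move=> [U [V [Y [nU nV rUV]]]] sX; have [W nW] := nth_syzygy_ex n X'.
have [U' nU' sW] := nth_syzygyS sX nW; have [V' sV] := syzygy_ex V.
exists W, V', Y; split=> //; first by rewrite addnS; exists V.
apply: retract0_syzygy sW sV; apply: retract_mod_trans _ rUV.
exact: nth_syzygy_retract nU' nU.
Qed.

Lemma pd_le_dell n k X : pd_le n X -> dell_le k n X.
Proof.
move=> pX; have [U nU] := nth_syzygy_ex n X.
have [V nV] := nth_syzygy_ex (n + k) X; exists U, V, X; split=> //.
(* [U] is projective, so its whole identity can be taken as the error term. *)
exists U, 0, 0, (idm U), (idm U); rewrite comp0m add0r comp1m; split=> //.
exact: (pd_le_nth_syzygy) pX nU.
Qed.

Lemma retract0_biproduct X P S i1 i2 p1 p2 :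
  @is_biproduct A X P S i1 i2 p1 p2 -> projective P -> retract_mod 0 S X.
Proof. by move=> [_ _ _ _ e] pP; exists P, p1, i1, p2, i2. Qed.

Lemma ddell_le_iso m k X X' :
  isomorphic X X' -> ddell_le m k X -> ddell_le m k X'.
Proof.
move=> [h ih]; have [h' [h'h hh']] := ih.
have rX : retract_mod 0 X' X by apply: retract_mod_split hh'.
case: m => [|m] [dX|//].
- by left; apply: dell_le_retract dX.
- by left; apply: dell_le_retract dX.
case=> C [Y [f [g [sfg dC dY]]]]; right; exists C, Y, f, (h \oc g).
by split=> //; apply: ses_iso_r.
Qed.

Lemma ddell_leS m k X : ddell_le m k X -> ddell_le m.+1 k X.
Proof.
elim: m k X => [|m IH] k X [dX|].
- by left; apply: dell_leW dX.
- by [].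
- by left; apply: dell_leW dX.
case=> C [Y [f [g [sfg dC dY]]]]; right; exists C, Y, f, g.
by split=> //; [apply: dell_leW dC|apply: IH].
Qed.

Lemma ddell_leW n m k X : (n <= m)%N -> ddell_le n k X -> ddell_le m k X.
Proof.
by move=> /subnK <-; elim: (m - n)%N => // d IH /IH; apply: ddell_leS.
Qed.

(** The horseshoe over the first step of the resolution gives a short exact sequence of syzygies,
    and every term gains one syzygy. *)
Lemma ddell_le_syzygy m k X X' :
  ddell_le m k X -> syzygy X' X -> ddell_le m k.+1 X'.
Proof.
elim: m k X X' => [|m IH] k X X' [dX|dX] sX //.
- by left; apply: dell_le_syzygy dX sX.
- by left; apply: dell_le_syzygy dX sX.
right; case: dX => C [Y [f [g [sfg dC dY]]]].
case: sX => P [kp [p [pP sP]]]; have [Q [q [pQ eq]]] := projA Y.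
have [Y' [a sY']] := ses_of_epi eq.
have [S [i1 [i2 [p1 [p2 [V [v [s [a' [w [bS sC sV]]]]]]]]]]] :=
  horseshoe sfg sY' sP pP.
exists V, Y', a', w; split=> //; last by apply: IH dY _; exists Q, a, q.
apply: dell_le_syzygy dC _; exists S, v, s.
by split=> //; apply: biproduct_projective bS pQ pP.
Qed.

(* Rotate X -> Y -> Z into Z' -> X + P -> Y with Z' a syzygy of Z, and resolve
   X + P by the resolution of X. *)
Lemma ddell_le_ses m n k X Y Z (f : hom X Y) (g : hom Y Z) :
    ses f g -> ddell_le m k X -> ddell_le n k Z ->
  ddell_le (m + n).+1 k Y.
Proof.
have dell_case m' l X0 Y0 Z0 (f0 : hom X0 Y0) (g0 : hom Y0 Z0) :
    ses f0 g0 -> dell_le l m' X0 -> ddell_le n l Z0 ->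
    ddell_le (m' + n).+1 l Y0.
  move=> sfg dX dZ.
  have [P [p [pP ep]]] := projA Z0; have [Z' [kp sP]] := ses_of_epi ep.
  have dZ' : ddell_le n l.+1 Z'.
    by apply: ddell_le_syzygy dZ _; exists P, kp, p.
  have [O zO] := zero_ex.
  (* Resolving [X0] by itself with zero kernel makes [S] the sum of [X0] and [P], and [V] isomorphic
     to [Z']. *)
  have [S [i1 [i2 [p1 [p2 [V [v [s [a' [w [bS sY sV]]]]]]]]]]] :=
    horseshoe sfg (ses_zero_id X0 zO) sP pP.
  right; exists S, V, v, s; split=> //.
    apply: dell_le_retract (retract0_biproduct bS pP) _.
    by apply: dell_leW dX; rewrite -addnS leq_addr.
  apply: (@ddell_leW n); first exact: leq_addl.
  apply: ddell_le_iso dZ'; apply: isomorphic_sym; exists w.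
  exact: ses_zero_iso sV zO.
elim: m k X Y Z f g => [|m IH] k X Y Z f g sfg [dX|dX] dZ //;
  try exact: dell_case sfg dX dZ.
case: dX => [C [X' [a [c [sX dC dX']]]]].
have [P [p [pP ep]]] := projA Z; have [Z' [kp sP]] := ses_of_epi ep.
(* [V] is an extension of [Z'] by [X'], so induction applies to it with [k.+1] in place of [k]. *)
have [S [i1 [i2 [p1 [p2 [V [v [s [a' [w [bS sY sV]]]]]]]]]]] :=
  horseshoe sfg sX sP pP.
right; exists S, V, v, s; split=> //.
  apply: dell_le_retract (retract0_biproduct bS pP) _.
  by apply: dell_leW dC; rewrite -addnS leq_addr.
by apply: IH sV dX' _; apply: ddell_le_syzygy dZ _; exists P, kp, p.
Qed.

Lemma ddell_le_length d k n X : (forall S : A, simple S -> ddell_le d k S) ->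
  composition_series X n -> ddell_le (n * d.+1).-1 k X.
Proof.
move=> dS; elim=> {n X} [X zX|X Y S n f g cX IH /(ses_short_exact) sfg sS].
  exact/ddell_le_dell/pd_le_dell/pd_le_zero.
(* Length one is separate: adding a simple object to a zero one by [ddell_le_ses] would give [d.+1]
   instead of [d]. *)
case: n cX IH => [|n] cX IH.
  inversion cX; rewrite mul1n; apply: ddell_le_iso (dS S sS).
  by apply: isomorphic_sym; exists g; apply: ses_zero_iso sfg _.
suff -> : (n.+2 * d.+1).-1 = ((n.+1 * d.+1).-1 + d).+1.
  exact: ddell_le_ses sfg IH (dS S sS).
by rewrite [in LHS]mulSn mulSn !addSn /= addnC addSn.
Qed.

(** A syzygy of [Z] is projective, so the sequence of syzygies splits and a syzygy of [X] is a
    retract of one of [Y]. This needs at least one syzygy, hence [n.+1]. *)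
Lemma dell_le_ses_pd1 k n X Y Z (f : hom X Y) (g : hom Y Z) :
  ses f g -> pd_le 1 Z -> dell_le k n Y -> dell_le k n.+1 X.
Proof.
move=> sfg pZ /(dell_leW (leqnSn n))[U [T [Y0 [nU nT rUT]]]].
have [C [c [pC ec]]] := projA X; have [X1 [a sX]] := ses_of_epi ec.
have [P [p [pP ep]]] := projA Z; have [Z1 [k1 sZ]] := ses_of_epi ep.
have pZ1 : projective Z1.
  by apply: (pd_le_syzygy (n := 0) pZ); exists P, k1, p.
have [S [i1 [i2 [p1 [p2 [V [v [s [a' [w [bS sY sV]]]]]]]]]]] :=
  horseshoe sfg sX sZ pP.
have [t [r [_ ra' _]]] := ses_split sV pZ1.
have [W1 nW1] := nth_syzygy_ex n X1.
have [W2 nW2] := nth_syzygy_ex n V.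
exists W1, T, Y0; split=> //; first by apply: nth_syzygyS nW1; exists C, a, c.
have r12 := retract0_nth_syzygy (retract_mod_split 0 ra') nW1 nW2.
apply: (retract_mod_trans r12); apply: retract_mod_trans _ rUT.
apply: (nth_syzygy_retract (n := n.+1)) nU; apply: nth_syzygyS nW2.
by exists S, v, s; split=> //; apply: biproduct_projective bS pC pP.
Qed.

(** Pulling [C] back along [f] leaves the kernel [X'] unchanged, and the pullback is again the
    kernel of an epimorphism onto [Z]. *)
Lemma ddell_le_ses_pd1 m k X Y Z (f : hom X Y) (g : hom Y Z) :
  ses f g -> pd_le 1 Z -> ddell_le m k Y -> ddell_le m.+1 k X.
Proof.
move=> sfg pZ; case: m => [|m] [dY|dY] //;
  try by left; exact: dell_le_ses_pd1 sfg pZ dY.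
case: dY => C [X' [a [b [sab dC dX']]]].
have [C' [m' [a' [b' [sC sX _ _]]]]] := ses_comp_kernel sab sfg.
right; exists C', X', a', b'; split=> //; last exact: ddell_leS.
exact: dell_le_ses_pd1 sC pZ dC.
Qed.

(** * Comparison with the chosen syzygies and with resolutions *)

Variable O : syzygies A.

Lemma syz_syzygy X : syzygy (syz O X) X.
Proof.
exists (cover O X), (syz_map O X), (cover_map O X).
by split; [apply: cover_projective|split; [apply: syz_kernel|apply: cover_epi]].
Qed.

Lemma Omega_nth_syzygy n X : nth_syzygy n X (Omega O n X).
Proof.
by elim: n => [|n IH] //; exists (Omega O n X) => //; apply: syz_syzygy.
Qed.

Lemma stable_retractP U V : stable_retract U V <-> retract_mod 0 U V.
Proof.
split=> [[s [r [P [u [v [pP e]]]]]]|[P [s [r [u [v [pP e]]]]]]].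
  by exists P, s, r, u, (- v); rewrite compNm -e opprB addrC subrK.
by exists s, r, P, u, (- v); split=> //; rewrite compNm -e opprD addNKr.
Qed.

(** Chosen and arbitrary syzygies are stable retracts of each other, so the choice [O] does not
    affect the level. *)
Lemma dellP k n X : (dell O k X <= n%:E)%en <-> dell_le k n X.
Proof.
rewrite einf_le; split; last first.
  move=> [U [V [Y [nU nV rUV]]]]; exists n => //; exists Y.
  apply/stable_retractP.
  apply: retract_mod_trans (nth_syzygy_retract (Omega_nth_syzygy n X) nU) _.
  apply: retract_mod_trans rUV _.
  exact: nth_syzygy_retract nV (Omega_nth_syzygy _ Y).
move=> [m lemn [Y /stable_retractP rY]].
apply: dell_leW lemn _; exists (Omega O m X), (Omega O (m + k) Y), Y.
by split=> //; apply: Omega_nth_syzygy.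
Qed.

Definition seq_cons (C0 : A) (C : nat -> A) (j : nat) : A :=
  if j is j'.+1 then C j' else C0.

(** This is [exact_resolution] without its length, which is kept apart because it shifts when a term
    is added or removed. *)
Definition aug_exact (C : nat -> A) (d : forall j, hom (C j.+1) (C j)) X
    (a : hom (C 0) X) : Prop :=
  [/\ is_epi a, exact (d 0) a & forall j, exact (d j.+1) (d j)].

Lemma aug_exact_cons C0 C (d : forall j, hom (C j.+1) (C j)) X Y
    (a : hom (C 0) Y) (f : hom Y C0) (g : hom C0 X) :
  ses f g -> aug_exact d a ->
  exists d' : forall j, hom (seq_cons C0 C j.+1) (seq_cons C0 C j),
    @aug_exact (seq_cons C0 C) d' X g.
Proof.
move=> [kf eg] [ea d0 dS].
exists (fun j => if j is j'.+1 as j return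
  hom (seq_cons C0 C j.+1) (seq_cons C0 C j) then d j' else f \oc a).
split=> //; first by exists Y, f, a.
case=> [|j] //=; case: d0 => K [k [u [kk eu dku]]]; exists K, k, u; split=> //.
apply: is_ker; [by rewrite -compA (ker0 kk) compm0|exact: ker_mono kk|].
by move=> W h; rewrite -compA => /(mono_eq0 (ker_mono kf)); apply: ker_lift.
Qed.

Lemma aug_exact_zero Z : is_zero Z ->
  @aug_exact (fun=> Z) (fun=> 0) Z 0.
Proof.
move=> zZ; have ex0 : exact (0 : hom Z Z) (0 : hom Z Z).
  exists Z, 0, 0; split; last by rewrite compm0.
    apply: is_ker; [exact: compm0|exact: from_zero_mono|].
    by move=> W h _; exists 0; rewrite compm0 (zero_to h zZ).
  exact: to_zero_epi.
by split=> //; apply: to_zero_epi.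
Qed.

Lemma aug_exact_behead C (d : forall j, hom (C j.+1) (C j)) X
    (a : hom (C 0) X) :
  aug_exact d a -> exists Y (f : hom Y (C 0)) (a' : hom (C 1) Y),
    ses f a /\ @aug_exact (fun j => C j.+1) (fun j => d j.+1) Y a'.
Proof.
move=> [ea [Y [f [a' [kf ea' d0]]]] dS]; exists Y, f, a'.
split=> //; split=> //.
case: (dS 0) => K [k [u [kk eu dku]]]; exists K, k, u; split=> //.
apply: is_ker.
- by apply: (mono_eq0 (ker_mono kf)); rewrite compA -d0 (ker0 kk).
- exact: ker_mono kk.
by move=> W h a'h0; apply: ker_lift kk _; rewrite d0 -compA a'h0 compm0.
Qed.

(** Removing [C 0] lowers [t] and [m] by one and raises [k] by one, which matches the bounds on the
    remaining terms. *)
Lemma ddell_le_resolution t m k X C (d : forall j, hom (C j.+1) (C j))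
    (a : hom (C 0) X) :
    (t <= m)%N -> aug_exact d a -> (forall j, (t < j)%N -> is_zero (C j)) ->
    (forall j, (j <= t)%N -> dell_le (j + k) (m - j) (C j)) ->
  ddell_le m k X.
Proof.
elim: t m k X C d a => [|t IH] m k X C d a letm.
  move=> /aug_exact_behead[Y [f [a' [sfa [ea' _ _]]]]] zC dC.
  have zY : is_zero Y by apply: epi0_zero ea' (zero_from _ (zC 1 _)).
  apply: (@ddell_le_iso _ _ (C 0)).
    by exists a; apply: ses_zero_iso sfa zY.
  by apply: ddell_le_dell; have := dC 0 isT; rewrite subn0.
move=> /aug_exact_behead[Y [f [a' [sfa exd]]]] zC dC.
case: m letm dC => // m letm dC; right; exists (C 0), Y, f, a; split=> //.
  exact: (dC 0).
apply: IH letm exd _ _ => j ltj; first exact: zC.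
by rewrite addnS -addSn -subSS; apply: dC.
Qed.

Lemma ddell_le_resolution_ex m k X : ddell_le m k X ->
  exists t (C : nat -> A) (d : forall j, hom (C j.+1) (C j)) (a : hom (C 0) X),
    [/\ (t <= m)%N, aug_exact d a, forall j, (t < j)%N -> is_zero (C j)
      & forall j, (j <= t)%N -> dell_le (j + k) (m - j) (C j)].
Proof.
have base n l Y : dell_le l n Y ->
    exists t C (d : forall j, hom (C j.+1) (C j)) (a : hom (C 0) Y),
    [/\ (t <= n)%N, aug_exact d a, forall j, (t < j)%N -> is_zero (C j)
      & forall j, (j <= t)%N -> dell_le (j + l) (n - j) (C j)].
  move=> dY; have [Z zZ] := zero_ex.
  have [d exd] := aug_exact_cons (ses_zero_id Y zZ) (aug_exact_zero zZ).
  exists 0, (seq_cons Y (fun=> Z)), d, (idm Y); split=> //; first by case.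
  by case=> // _; rewrite subn0.
elim: m k X => [|m IH] k X [dX|] //; try exact: base dX.
move=> [C0 [Y [f [g [sfg dC0 /IH[t [C [d [a [letm exd zC dC]]]]]]]]]].
have [d' exd'] := aug_exact_cons sfg exd.
exists t.+1, (seq_cons C0 C), d', g; split=> //.
  by case=> // j; apply: zC.
by case=> [|j] lej //=; rewrite subSS addSnnS; apply: dC.
Qed.

Lemma ddellP k m X : (ddell O k X <= m%:E)%en <-> ddell_le m k X.
Proof.
rewrite einf_le; split.
  move=> [n lenm [t [C [d [a [letn [ea d0 dS zC] dC]]]]]].
  apply: ddell_leW lenm _; apply: (ddell_le_resolution letn _ zC).
    by split; [exact: ea|exact: d0|exact: dS].
  by move=> j lej; apply/dellP/dC.
move=> /ddell_le_resolution_ex[t [C [d [a [letm [ea d0 dS] zC dC]]]]].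
exists m => //; exists t, C, d, a; split=> // j lej; exact/dellP/dC.
Qed.

Lemma ddell_catP k m :
  (ddell_cat O k <= m%:E)%en <-> forall S : A, simple S -> ddell_le m k S.
Proof.
by rewrite esup_le; split=> H S /H /ddellP.
Qed.

Lemma pd_leP n X : (pd X <= n%:E)%en <-> pd_le n X.
Proof.
rewrite einf_le; split.
  move=> [m lemn [P [d [a [[ea d0 dS zP] pP]]]]].
  have : aug_exact d a by split; [exact: ea|exact: d0|exact: dS].
  have {}pP j : projective (P j).
    by case: (leqP j m) => [/pP //|/zP]; apply: zero_projective.
  have {}zP j : (n < j)%N -> is_zero (P j).
    by move=> ltnj; apply: zP; apply: leq_ltn_trans ltnj.
  elim: n X P d a pP zP {m lemn ea d0 dS} => [|n IH] X P d a pP zP.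
    move=> /aug_exact_behead[Y [f [a' [sfa [ea' _ _]]]]].
    have zY : is_zero Y by apply: epi0_zero ea' (zero_from _ (zP 1 _)).
    have [b [_ ab]] := ses_zero_iso sfa zY.
    by apply: (@retract0_pd_le 0) (retract_mod_split 0 ab) (pP 0).
  move=> /aug_exact_behead[Y [f [a' [sfa exd]]]].
  exists Y; first by exists (P 0), f, a.
  by apply: (IH _ _ _ _ _ _ exd) => // j ltnj; apply: zP.
move=> pX; exists n => //.
suff [P [d [a [[ea d0 dS] zP pP]]]] : exists (P : nat -> A)
    (d : forall j, hom (P j.+1) (P j)) (a : hom (P 0) X),
    [/\ aug_exact d a, forall j, (n < j)%N -> is_zero (P j)
      & forall j, projective (P j)].
  by exists P, d, a.
elim: n X pX => [|n IH] X.
  move=> pX; have [Z zZ] := zero_ex.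
  have [d exd] := aug_exact_cons (ses_zero_id X zZ) (aug_exact_zero zZ).
  exists (seq_cons X (fun=> Z)), d, (idm X); split=> //; case=> //= _.
  exact: zero_projective.
move=> [U [P0 [kp [p [pP0 sU]]]] /IH[P [d [a [exd zP pP]]]]].
have [d' exd'] := aug_exact_cons sU exd.
exists (seq_cons P0 P), d', p; split=> //; case=> // j; exact: zP.
Qed.

End Abelian.

(** * Adjoint and exact functors *)

Section Adjunctions.
Variables (A B : preadditive) (F : functor A B) (G : functor B A).
Variable adj : adjunction F G.
Local Notation eta := (adj_unit adj).
Local Notation eps := (adj_counit adj).

Lemma adjunct_left_inj X Y (g h : hom (F X) Y) :
  fmap G g \oc eta X = fmap G h \oc eta X -> g = h.
Proof.
suff key (x : hom (F X) Y) : x = eps Y \oc fmap F (fmap G x \oc eta X).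
  by move=> e; rewrite (key g) (key h) e.
by rewrite fmapM compA adj_counit_nat -compA adj_triangleF compm1.
Qed.

Lemma adjunct_right_inj X Y (x y : hom X (G Y)) :
  eps Y \oc fmap F x = eps Y \oc fmap F y -> x = y.
Proof.
suff key (z : hom X (G Y)) : z = fmap G (eps Y \oc fmap F z) \oc eta X.
  by move=> e; rewrite (key x) (key y) e.
by rewrite fmapM -compA -adj_unit_nat compA adj_triangleG comp1m.
Qed.

Lemma left_adjoint_epi X Y (f : hom X Y) : is_epi f -> is_epi (fmap F f).
Proof.
move=> ef Z g h e; apply: adjunct_left_inj; apply: ef.
by rewrite -!compA adj_unit_nat !compA -!fmapM e.
Qed.

Lemma right_adjoint_mono X Y (f : hom X Y) : is_mono f -> is_mono (fmap G f).
Proof.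
move=> mf Z g h e; apply: adjunct_right_inj; apply: mf.
by rewrite !compA -!adj_counit_nat -!compA -!fmapM e.
Qed.

Lemma right_adjoint_zero Z : is_zero Z -> is_zero (G Z).
Proof.
move=> zZ; apply: is_zero_id; apply: adjunct_right_inj.
exact: etrans (zero_to _ zZ) (esym (zero_to _ zZ)).
Qed.

Lemma left_adjoint_projective :
  (forall X Y (f : hom X Y), is_epi f -> is_epi (fmap G f)) ->
  forall P, projective P -> projective (F P).
Proof.
move=> Gepi P pP X Y f ef g.
have [h e] := pP _ _ _ (Gepi _ _ f ef) (fmap G g \oc eta P).
exists (eps X \oc fmap F h).
by rewrite compA -adj_counit_nat -compA -fmapM e fmapM compA adj_counit_nat
  -compA adj_triangleF compm1.
Qed.

Lemma right_adjoint_epi (projA : enough_projectives A) :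
  (forall P, projective P -> projective (F P)) ->
  forall X Y (f : hom X Y), is_epi f -> is_epi (fmap G f).
Proof.
move=> Fproj X Y f ef; apply: (epi_by_projectives projA) => P y /Fproj pFP.
have [h fh] := pFP _ _ _ ef (eps Y \oc fmap F y); exists (fmap G h \oc eta P).
rewrite compA -fmapM fh fmapM -compA -adj_unit_nat.
by rewrite compA adj_triangleG comp1m.
Qed.

(** The inverse is the preimage under [F] of the counit at [F X]. *)
Lemma unit_iso X : fully_faithful F -> is_iso (eta X).
Proof.
move=> ffF; have [k kK Kk] := ffF (G (F X)) X.
have e : fmap F (k (eps (F X))) = eps (F X) by apply: Kk.
exists (k (eps (F X))); split.
  have [k' k'K _] := ffF X X.
  by apply: (can_inj k'K); rewrite /= fmapM e adj_triangleF fmap1.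
apply: adjunct_right_inj.
by rewrite fmapM e compA adj_triangleF comp1m fmap1 compm1.
Qed.

Lemma counit_iso Y : fully_faithful G -> is_iso (eps Y).
Proof.
move=> ffG; have [k kK Kk] := ffG Y (F (G Y)).
have e : fmap G (k (eta (G Y))) = eta (G Y) by apply: Kk.
exists (k (eta (G Y))); split.
  apply: adjunct_left_inj.
  by rewrite fmapM e -compA adj_triangleG compm1 fmap1 comp1m.
have [k' k'K _] := ffG Y Y.
by apply: (can_inj k'K); rewrite /= fmapM e adj_triangleG fmap1.
Qed.

Hypothesis abB : is_abelian B.

Lemma right_adjoint0 X Y : fmap G (0 : hom X Y) = 0.
Proof.
have [Z zZ] := zero_ex abB.
rewrite -(compm0 X (0 : hom Z Y)) fmapM.
rewrite (zero_to (fmap G (0 : hom X Z))) ?compm0 //.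
exact: right_adjoint_zero.
Qed.

(** A right adjoint preserves the biproduct of [Y] with itself, and [f + g] factors through it by
    [p1 + p2]. *)
Lemma right_adjointD X Y (f g : hom X Y) :
  fmap G (f + g) = fmap G f + fmap G g.
Proof.
have [S [i1 [i2 [p1 [p2 bS]]]]] := biproduct_ex abB Y Y.
case: (bS) => e11 e22 e12 e21 eS.
have jointly_mono W (x y : hom W (G S)) : fmap G p1 \oc x = fmap G p1 \oc y ->
    fmap G p2 \oc x = fmap G p2 \oc y -> x = y.
  have h (p : hom S Y) z :
      p \oc (eps S \oc fmap F z) = eps Y \oc fmap F (fmap G p \oc z).
    by rewrite fmapM !compA adj_counit_nat.
  move=> e1 e2; apply: adjunct_right_inj; rewrite -[LHS]comp1m -[RHS]comp1m -eS.
  by rewrite !compDl -!compA !h e1 e2.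
have eGS : fmap G i1 \oc fmap G p1 + fmap G i2 \oc fmap G p2 = idm (G S).
  apply: jointly_mono; rewrite compDr !compA -!fmapM.
    by rewrite e11 e12 comp0m comp1m right_adjoint0 addr0 compm1.
  by rewrite e22 e21 comp0m comp1m right_adjoint0 add0r compm1.
have -> : f + g = (p1 + p2) \oc (i1 \oc f + i2 \oc g).
  have := biproduct_comp f g (idm Y) (idm Y) bS.
  by rewrite !comp1m.
have Gh : fmap G (i1 \oc f + i2 \oc g) =
    fmap G i1 \oc fmap G f + fmap G i2 \oc fmap G g.
  apply: jointly_mono; rewrite compDr !compA -!fmapM compDr !compA.
    by rewrite e11 e12 !comp0m comp1m right_adjoint0 !addr0.
  by rewrite e22 e21 !comp0m comp1m right_adjoint0 !add0r.
rewrite fmapM Gh compDr !compA -!fmapM !compDl e11 e22 e12 e21.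
by rewrite !comp0m addr0 add0r !comp1m.
Qed.

Lemma right_adjoint_kernel X Y (f : hom X Y) K (k : hom K X) :
  is_kernel f k -> is_kernel (fmap G f) (fmap G k).
Proof.
move=> kk; apply: is_ker.
- by rewrite -fmapM (ker0 kk) right_adjoint0.
- exact/right_adjoint_mono/(ker_mono kk).
move=> W h fh0; have [u ku] : exists u, k \oc u = eps X \oc fmap F h.
  apply: ker_lift kk _; apply: adjunct_left_inj.
  rewrite right_adjoint0 comp0m !fmapM -!compA -adj_unit_nat.
  by rewrite (compA (fmap G (eps X))) adj_triangleG comp1m.
exists (fmap G u \oc eta W).
rewrite compA -fmapM ku fmapM -compA -adj_unit_nat.
by rewrite compA adj_triangleG comp1m.
Qed.

End Adjunctions.

(** * Exact functors and their effect on syzygies *)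

Section ExactFunctors.
Variables (A B : preadditive) (F : functor A B).

Definition exact_functor : Prop :=
  (forall X Y (f g : hom X Y), fmap F (f + g) = fmap F f + fmap F g) /\
  (forall X Y Z (f : hom X Y) (g : hom Y Z),
     ses f g -> ses (fmap F f) (fmap F g)).

Lemma functor_iso X Y (f : hom X Y) : is_iso f -> is_iso (fmap F f).
Proof.
by move=> [g [gf fg]]; exists (fmap F g); rewrite -!fmapM gf fg !fmap1.
Qed.

Hypothesis exF : exact_functor.

Lemma exact_functor0 X Y : fmap F (0 : hom X Y) = 0.
Proof. by apply: (addIr (fmap F (0 : hom X Y))); rewrite -exF.1 !add0r. Qed.

Lemma exact_functor_epi (abA : is_abelian A) X Y (f : hom X Y) :
  is_epi f -> is_epi (fmap F f).
Proof. by move=> /(ses_of_epi abA)[K [k /exF.2[]]]. Qed.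

Lemma exact_functor_mono (abA : is_abelian A) X Y (f : hom X Y) :
  is_mono f -> is_mono (fmap F f).
Proof. by move=> /(ses_of_mono abA)[K [k /exF.2[/ker_mono]]]. Qed.

(** The bound [n] allows for functors that do not preserve projectives; it is 2 for [r]. *)
Lemma retract_mod_functor n X Y :
  (forall P, projective P -> pd_le n (F P)) ->
  retract_mod 0 X Y -> retract_mod n (F X) (F Y).
Proof.
move=> Fn [P [s [r [u [v [pP e]]]]]].
exists (F P), (fmap F s), (fmap F r), (fmap F u), (fmap F v).
by split; [apply: Fn|rewrite -!fmapM -exF.1 e fmap1].
Qed.

Hypothesis projF : forall P, projective P -> projective (F P).

Lemma syzygy_functor X U : syzygy U X -> syzygy (F U) (F X).
Proof.
move=> [P [k [p [pP sP]]]]; exists (F P), (fmap F k), (fmap F p).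
by split; [apply: projF|apply: exF.2].
Qed.

Lemma nth_syzygy_functor n X U : nth_syzygy n X U -> nth_syzygy n (F X) (F U).
Proof.
elim: n U => [|n IH] U /=; first by move=> ->.
by move=> [V /IH nV /syzygy_functor sU]; exists (F V).
Qed.

Lemma dell_le_functor k n X : dell_le k n X -> dell_le k n (F X).
Proof.
move=> [U [V [Y [nU nV rUV]]]]; exists (F U), (F V), (F Y).
by split; [apply: nth_syzygy_functor..|apply: retract_mod_functor].
Qed.

Lemma ddell_le_functor m k X : ddell_le m k X -> ddell_le m k (F X).
Proof.
elim: m k X => [|m IH] k X [dX|dX] //; try by left; apply: dell_le_functor.
case: dX => [C [Y [f [g [sfg dC dY]]]]]; right.
exists (F C), (F Y), (fmap F f), (fmap F g).
by split; [apply: exF.2|apply: dell_le_functor|apply: IH].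
Qed.

End ExactFunctors.

Lemma right_adjoint_exact (A B : preadditive) (F : functor A B)
    (G : functor B A) (adj : adjunction F G) (abB : is_abelian B) :
    (forall (X Y : B) (f : hom X Y), is_epi f -> is_epi (fmap G f)) ->
  exact_functor G.
Proof.
move=> Gepi; split; first exact: right_adjointD adj abB.
move=> X Y Z f g [kf eg]; split; last exact: Gepi.
exact: (right_adjoint_kernel adj abB kf).
Qed.

(** * Recollements *)

Section Recollement.
Variables (A B C : preadditive) (R : recollement A B C).
Hypotheses (abA : is_abelian A) (abB : is_abelian B) (abC : is_abelian C).
Hypotheses (projA : enough_projectives A) (projB : enough_projectives B)
  (projC : enough_projectives C).
Local Notation i := (rec_i R).
Local Notation e := (rec_e R).
Local Notation l := (rec_l R).
Local Notation r := (rec_r R).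
Local Notation eta X := (adj_unit (adj_er R) X).
Local Notation eps X := (adj_counit (adj_le R) X).

Lemma i_exact : exact_functor i.
Proof.
exact: right_adjoint_exact (adj_qi R) abA (left_adjoint_epi (adj_ip R)).
Qed.

Lemma e_exact : exact_functor e.
Proof.
exact: right_adjoint_exact (adj_le R) abB (left_adjoint_epi (adj_er R)).
Qed.

Lemma e_i_zero X : is_zero (e (i X)).
Proof. by apply/rec_im_ker; exists X, (idm (i X)); apply: iso_id. Qed.

Lemma e_l_iso X : is_iso (adj_unit (adj_le R) X).
Proof. exact/unit_iso/rec_l_ff. Qed.

Lemma e_r_iso X : is_iso (adj_counit (adj_er R) X).
Proof. exact/counit_iso/rec_r_ff. Qed.

Lemma e_counit_iso X : is_iso (fmap e (eps X)).
Proof.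
have [g [g1 g2]] := e_l_iso (e X); have e1 := adj_triangleG (adj_le R) X.
exists (adj_unit (adj_le R) (e X)); split=> //.
suff -> : fmap e (eps X) = g by [].
by rewrite -[LHS]compm1 -g2 compA e1 comp1m.
Qed.

Lemma e_unit_iso X : is_iso (fmap e (eta X)).
Proof.
have [g [g1 g2]] := e_r_iso (e X); have e1 := adj_triangleF (adj_er R) X.
exists (adj_counit (adj_er R) (e X)); split=> //.
suff -> : fmap e (eta X) = g by [].
by rewrite -[LHS]comp1m -g1 -compA e1 compm1.
Qed.

(** This and its dual put the kernels and cokernels of the maps [l e X -> X] and [X -> r e X] into
    the image of [i]. *)
Lemma e_annihilated_sub X Y (f : hom X Y) K (k : hom K X) :
  is_mono (fmap e f) -> is_mono k -> f \oc k = 0 -> is_zero (e K).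
Proof.
move=> mf mk fk0; apply: (mono0_zero (exact_functor_mono e_exact abB mk)).
by apply: (mono_eq0 mf); rewrite -fmapM fk0 (exact_functor0 e_exact).
Qed.

Lemma e_annihilated_quotient X Y (f : hom X Y) Q (q : hom Y Q) :
  is_epi (fmap e f) -> is_epi q -> q \oc f = 0 -> is_zero (e Q).
Proof.
move=> ef eq qf0; apply: (epi0_zero (exact_functor_epi e_exact abB eq)).
by apply: (epi_eq0 ef); rewrite -fmapM qf0 (exact_functor0 e_exact).
Qed.

(** A subobject [U] of [e S] corresponds to a map from [l U] to [S], whose image is zero or all of
    [S]. *)
Lemma e_simple S : simple S -> ~ is_zero (e S) -> simple (e S).
Proof.
move=> [_ simS] nz; split=> // U f mf.
pose t := eps S \oc fmap l f.
have ft : f = fmap e t \oc adj_unit (adj_le R) U.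
  by rewrite fmapM -compA -adj_unit_nat compA adj_triangleG comp1m.
have [I [u [m [eu mm tmu]]]] := image_ex abB t.
have [zI|/iso_epi em] := simS _ _ mm.
  left; apply: (mono0_zero mf).
  by rewrite ft tmu (zero_from m zI) comp0m (exact_functor0 e_exact) comp0m.
right; apply: (mono_epi_iso abC mf); rewrite ft; apply: epi_comp.
  by rewrite tmu; apply: (exact_functor_epi e_exact abB); apply: epi_comp.
exact/iso_epi/e_l_iso.
Qed.

(** * Consequences of the bound on projective dimensions over the image of [i] *)

Hypothesis pd_i : forall X, pd_le 1 (i X).

Lemma pd_le_ker_e X : is_zero (e X) -> pd_le 1 X.
Proof.
move=> /rec_im_ker[Y [f [g [gf fg]]]].
exact: (retract0_pd_le abB projB) (retract_mod_split abB 0 fg) (pd_i Y).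
Qed.

(* The image of l e P -> P is projective, as a syzygy of the cokernel, which
   lies in the image of i; hence the counit splits off its image. *)
Lemma e_projective P : projective P -> projective (e P).
Proof.
move=> pP; have [I [u [m [eu mm mu]]]] := image_ex abB (eps P).
have [Q [q sQ]] := ses_of_mono abB mm.
have pI : projective I.
  apply: (pd_le_syzygy abB projB (n := 0) (X := Q)); last by exists P, m, q.
  apply/pd_le_ker_e/(e_annihilated_quotient _ sQ.2 (f := eps P)).
    exact/iso_epi/e_counit_iso.
  by rewrite mu compA (ker0 sQ.1) comp0m.
have [s us] := pI _ _ _ eu (idm I).
(* [fmap e m \oc fmap e u] is invertible, so [fmap e u] is mono and its section is a two-sided
   inverse. *)
have su : fmap e s \oc fmap e u = idm _.
  have mu_e : is_mono (fmap e u).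
    apply: (@mono_cancel _ _ _ _ (fmap e m)).
    by rewrite -fmapM -mu; apply/iso_mono/e_counit_iso.
  by apply: mu_e; rewrite compA -fmapM us fmap1 comp1m compm1.
move=> X Y f ef g.
(* Lift along [fmap l f], which is epi, then apply [e] and identify [e l] with the identity. *)
have [h lfh] := pI _ _ _ (left_adjoint_epi (adj_le R) ef) (fmap l g \oc s).
have [v [v1 v2]] := e_l_iso X; have [v' [v1' v2']] := e_l_iso Y.
exists (v \oc fmap e h \oc fmap e u \oc adj_unit (adj_le R) (e P)).
have fv : f \oc v = v' \oc fmap e (fmap l f).
  rewrite -[RHS]compm1 -v2 -compA (compA (fmap e _)) -adj_unit_nat.
  by rewrite !compA v1' comp1m.
rewrite !compA fv -(compA v') -fmapM lfh fmapM.
rewrite -(compA v') -(compA _ _ (fmap e u)) su.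
by rewrite compm1 -compA -adj_unit_nat compA v1' comp1m.
Qed.

Lemma r_exact : exact_functor r.
Proof.
apply: right_adjoint_exact (adj_er R) abC _.
exact: (right_adjoint_epi (adj_er R) projB e_projective).
Qed.

(** [l (e X)] is projective, and the kernel and cokernel of the counit to [X] have projective
    dimension at most 1; so its image, and then [X], have at most 2. *)
Lemma pd_le2_e_projective X : projective (e X) -> pd_le 2 X.
Proof.
move=> peX; have plX : projective (l (e X)).
  apply: (left_adjoint_projective (adj_le R)) => // ? ? f.
  exact: (exact_functor_epi e_exact abB).
have [I [u [m [eu mm emu]]]] := image_ex abB (eps X).
have [K [k sK]] := ses_of_epi abB eu; have [Q [q sQ]] := ses_of_mono abB mm.
have pQ : pd_le 1 Q.
  apply/pd_le_ker_e/(e_annihilated_quotient _ sQ.2 (f := eps X)).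
    exact/iso_epi/e_counit_iso.
  by rewrite emu compA (ker0 sQ.1) comp0m.
have pK : pd_le 1 K.
  apply/pd_le_ker_e/(e_annihilated_sub _ (ker_mono sK.1) (f := eps X)).
    exact/iso_mono/e_counit_iso.
  by rewrite emu -compA (ker0 sK.1) compm0.
apply: (pd_le_ses abB projB sQ); last exact: (pd_leS abB pQ).
by exists K => //; exists (l (e X)), k, u.
Qed.

Lemma pd_le_r_projective P : projective P -> pd_le 2 (r P).
Proof.
move=> pP; apply: pd_le2_e_projective; have [g [g1 g2]] := e_r_iso P.
exact: (retract0_pd_le abC projC (n := 0)) (retract_mod_split abC 0 g1) pP.
Qed.

(** Apply [r] to a presentation of the last syzygy: its middle term has projective dimension at most
    2, so [ses_nth_syzygy] exchanges [r] with one syzygy after two others. *)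
Lemma r_nth_syzygy n X U W W' : nth_syzygy n X U ->
    nth_syzygy 2 (r U) W -> nth_syzygy n.+2 (r X) W' ->
  retract_mod 0 W W' /\ retract_mod 0 W' W.
Proof.
elim: n U W W' => [|n IH] U W W' /=.
  move=> -> nW nW'; have H := nth_syzygy_retract abB projB (n := 2) (X := r X).
  by split; [apply: H nW nW'|apply: H nW' nW].
move=> [V nV [P [k [p [pP sV]]]]] nW [W1 nW1 sW'].
have prP := pd_le_r_projective pP.
have [W2 nW2] := nth_syzygy_ex abB projB 2 (r V).
have [W3 sW3] := syzygy_ex abB projB W2.
have [r12 r21] := ses_nth_syzygy abB projB (r_exact.2 _ _ _ _ _ sV) prP nW
  (ex_intro2 _ _ _ nW2 sW3).
have [r12' r21'] := IH _ _ _ nV nW2 nW1.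
split.
  apply: (retract_mod_trans abB projB r12).
  exact: (retract0_syzygy abB projB r12' sW3 sW').
apply: (retract_mod_trans abB projB _ r21).
exact: (retract0_syzygy abB projB r21' sW' sW3).
Qed.

(* The shift by 2 is the bound on pd (r P) for P projective. *)
Lemma r_dell_le k n X : dell_le k n X -> dell_le k n.+2 (r X).
Proof.
move=> [U [V [Y [nU nV rUV]]]].
have [U2 nU2] := nth_syzygy_ex abB projB 2 (r U).
have [V2 nV2] := nth_syzygy_ex abB projB 2 (r V).
have [W nW] := nth_syzygy_ex abB projB n.+2 (r X).
have [T nT] := nth_syzygy_ex abB projB (n + k).+2 (r Y).
exists W, T, (r Y); split=> //.
(* The error of the retract after [r] has projective dimension at most 2; two syzygies make it
   projective. *)
have rUV2 : retract_mod 0 U2 V2.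
  have rr := retract_mod_functor r_exact pd_le_r_projective rUV.
  exact: (retract_mod_nth_syzygy abB projB rr nU2 nV2).
apply: (retract_mod_trans abB projB (r_nth_syzygy nU nU2 nW).2).
exact: (retract_mod_trans abB projB rUV2 (r_nth_syzygy nV nV2 nT).1).
Qed.

Lemma r_ddell_le m k X : ddell_le m k X -> ddell_le m.+2 k (r X).
Proof.
elim: m k X => [|m IH] k X [dX|dX] //; try by left; apply: r_dell_le.
case: dX => [D [Y [f [g [sfg dD dY]]]]]; right.
exists (r D), (r Y), (fmap r f), (fmap r g).
by split; [apply: r_exact.2|apply: r_dell_le|apply: IH].
Qed.

(** If [e S] is zero, then [S] has projective dimension at most 1. Otherwise the unit embeds [S]
    into [r (e S)] with cokernel in the image of [i]: [r] costs 2 and the embedding 1. *)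
Lemma ddell_le_simple m k S : simple S ->
  (simple (e S) -> ddell_le m k (e S)) -> ddell_le m.+3 k S.
Proof.
move=> sS dS; have [zS|nzS] := pselect (is_zero (e S)).
  apply/ddell_le_dell/(dell_leW abB projB (n := 1)) => //.
  exact/(pd_le_dell abB projB)/pd_le_ker_e.
have meta : is_mono (eta S).
  have [K [k0 kk]] := kernel_ex abB (eta S).
  have [zK|ik] := sS.2 _ _ (ker_mono kk); first exact: ker_zero_mono kk zK.
  case: nzS; apply: (mono0_zero (iso_mono (e_unit_iso S))).
  by rewrite (epi_eq0 (iso_epi ik) (ker0 kk)) (exact_functor0 e_exact).
have [Q [q sQ]] := ses_of_mono abB meta.
apply: (ddell_le_ses_pd1 abB projB sQ); last exact/r_ddell_le/dS/e_simple.
apply/pd_le_ker_e/(e_annihilated_quotient _ sQ.2 (f := eta S)).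
  exact/iso_epi/e_unit_iso.
exact: ker0 sQ.1.
Qed.

(* Ext^1(i P, i L) = 0: the pushout E of n along y is an extension of i P by
   i L, so it lies in the kernel of e, hence comes from A, where it splits. *)
Lemma extend_along_kernel N Q P L (n : hom N Q) (b : hom Q (i P))
    (y : hom N (i L)) :
  ses n b -> projective P -> exists y', y' \oc n = y.
Proof.
move=> snb pP; have [S [i1 [i2 [p1 [p2 bS]]]]] := biproduct_ex abB Q (i L).
case: (bS) => e11 e22 e12 e21 eS; pose d := i1 \oc n - i2 \oc y.
have p1d : p1 \oc d = n by rewrite compBr !compA e11 e12 comp0m comp1m subr0.
have md : is_mono d.
  by apply: (@mono_cancel _ _ _ _ p1); rewrite p1d; apply: ker_mono snb.1.
have [E [q sE]] := ses_of_mono abB md.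
have [h hq] : exists h, h \oc q = b \oc p1.
  by apply: coker_desc (ses_coker abB sE) _; rewrite -compA p1d (ker0 snb.1).
have q12 : q \oc i1 \oc n = q \oc i2 \oc y.
  by apply/subr0_eq; rewrite -!compA -compBr (ker0 sE.1).
(* [E] is an extension of [i P] by [i L]; exactness is tested on projectives, lifted to the
   biproduct. *)
have kj : is_kernel h (q \oc i2).
  apply: (kernel_by_projectives abB projB).
  - by rewrite compA hq -compA e12 compm0.
  - apply: is_mono0 => W x; rewrite -compA => /(ker_lift sE.1)[z dz].
    have z0 : z = 0.
      apply: (mono_eq0 (ker_mono snb.1)).
      by rewrite -p1d -compA dz compA e12 comp0m.
    by apply: (mono_eq0 (split_mono e22)); rewrite -dz z0 compm0.
  move=> T x pT hx0; have [x' qx'] := pT _ _ _ sE.2 x.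
  have [z nz] : exists z, n \oc z = p1 \oc x'.
    by apply: ker_lift snb.1 _; rewrite compA -hq -compA qx'.
  exists (p2 \oc x' + y \oc z); rewrite -qx'.
  apply/esym/subr0_eq; rewrite -compA -compBr.
  suff -> : x' - i2 \oc (p2 \oc x' + y \oc z) = d \oc z.
    by rewrite compA (ker0 sE.1) comp0m.
  rewrite -{1}[x']comp1m -eS compDl -!compA -nz compDr compBl -!compA.
  by rewrite opprD addrA addrK.
(* Since [e] kills [i P], [fmap e n] is split epi; so [e] kills [q] on both summands, while
   [fmap e q] is epi. *)
have zeE : is_zero (e E).
  apply: (epi0_zero (exact_functor_epi e_exact abB sE.2)).
  have q20 : fmap e (q \oc i2) = 0 by apply: zero_from; apply: e_i_zero.
  have [t nt] : exists t, fmap e n \oc t = idm (e Q).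
    apply: ker_lift (e_exact.2 _ _ _ _ _ snb).1 _.
    by apply: zero_to; apply: e_i_zero.
  have q10 : fmap e (q \oc i1) = 0.
    apply: (epi_eq0 (split_epi nt)).
    by rewrite -fmapM q12 fmapM q20 comp0m.
  rewrite -[q]compm1 -eS compDr !compA e_exact.1 !(fmapM _ (_ \oc _)) q10 q20.
  by rewrite !comp0m addr0.
(* Through [i E'] isomorphic to [E], [h] comes from an epimorphism onto [P] in [A], which splits. *)
move/rec_im_ker: zeE => [E' [phi iphi]].
have [inv invK Kinv] := rec_i_ff R E' P.
have h0 : fmap i (inv (h \oc phi)) = h \oc phi by apply: Kinv.
have eh : is_epi h.
  apply: (@epi_cancel _ _ _ _ _ q); rewrite hq.
  exact: epi_comp snb.2 (split_epi e11).
have eh0 : is_epi (inv (h \oc phi)).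
  move=> W x z exz; have [inv' inv'K _] := rec_i_ff R P W.
  apply: (can_inj inv'K) => /=.
  apply: (epi_comp eh (iso_epi iphi)).
  by rewrite -h0 -!fmapM exz.
have [s0 hs0] := pP _ _ _ eh0 (idm P).
have [s hs] : exists s, h \oc s = idm (i P).
  by exists (phi \oc fmap i s0); rewrite compA -h0 -fmapM hs0 fmap1.
(* The section [s] corrects [q \oc i1] to a map into the kernel of [h], which restricts to [y] along
   [n]. *)
have [y' jy'] : exists y', q \oc i2 \oc y' = q \oc i1 - s \oc b.
  apply: ker_lift kj _.
  by rewrite compBr !compA hq hs -compA e11 compm1 comp1m subrr.
exists y'; apply: (ker_mono kj).
by rewrite compA jy' compBl q12 -(compA s) (ker0 snb.1) compm0 subr0.
Qed.

(** The kernel [M] of [Q -> i P -> i X] is projective and is an extension of [i K] by [N]. A lift on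
    [M] is corrected so as to vanish on [N], and then descends to [i K]. *)
Lemma pd_le_A (X : A) : pd_le 1 X.
Proof.
have [P [p [pP ep]]] := projA X; have [K [k sK]] := ses_of_epi abA ep.
exists K; first by exists P, k, p.
move=> U V f ef g; have [L [u sL]] := ses_of_epi abA ef.
have [Q [b [pQ eb]]] := projB (i P); have [N [n sN]] := ses_of_epi abB eb.
have [M [m [n' [b' [sM sN' mn' kb']]]]] :=
  ses_comp_kernel abB projB sN (i_exact.2 _ _ _ _ _ sK).
have pM : projective M.
  apply: (pd_le_syzygy abB projB (n := 0) (pd_i X)).
  by exists Q, m, (fmap i p \oc b).
have iL := i_exact.2 _ _ _ _ _ sL.
have [phi fphi] := pM _ _ _ iL.2 (fmap i g \oc b').
have [psi upsi] : exists psi, fmap i u \oc psi = phi \oc n'.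
  by apply: ker_lift iL.1 _; rewrite compA fphi -compA (ker0 sN'.1) compm0.
(* The lift maps [N] into [i L]; this restriction extends to [Q], and subtracting the extension from
   [phi] kills it on [N]. *)
have [psi' psi'n] := extend_along_kernel psi sN pP.
have [th thb'] : exists th, th \oc b' = phi - fmap i u \oc psi' \oc m.
  apply: coker_desc (ses_coker abB sN') _.
  by rewrite compBl -upsi -!compA mn' psi'n subrr.
have [inv invK Kinv] := rec_i_ff R K U.
have [inv' inv'K _] := rec_i_ff R K V.
exists (inv th); apply: (can_inj inv'K); rewrite /= fmapM Kinv.
apply: sN'.2; rewrite -compA thb' compBr fphi !compA (ker0 iL.1).
by rewrite !comp0m subr0.
Qed.

(** * Bounds between the two derived delooping levels *)

Lemma ddell_cat_B_le (OB : syzygies B) (OC : syzygies C) k c :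
  (ddell_cat OC k <= c%:E)%en -> (ddell_cat OB k <= c.+3%:E)%en.
Proof.
move/(ddell_catP abC projC) => dC; apply/(ddell_catP abB projB) => S sS.
by apply: ddell_le_simple => // /dC.
Qed.

Lemma ddell_cat_C_le (OB : syzygies B) (OC : syzygies C) k d L :
    (ddell_cat OB k <= d%:E)%en -> (L_l R <= L%:E)%en ->
  (ddell_cat OC k <= (L * (d + 1) - 1)%:E)%en.
Proof.
move/(ddell_catP abB projB) => dB /esup_le lenL.
apply/(ddell_catP abC projC) => T sT.
have [m lemL cT] := (einf_le _ _).1 (lenL T sT).
(* The bound for [l T] passes to [e (l T)], which is isomorphic to [T]. *)
have := ddell_le_functor e_exact e_projective (ddell_le_length abB projB dB cT).
move/(ddell_le_iso abC projC (isomorphic_sym (ex_intro _ _ (e_l_iso T)))).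
apply: ddell_leW => //.
by rewrite -subn1 addn1 leq_sub2r // leq_mul2r lemL orbT.
Qed.

End Recollement.

(** * Finiteness of [L_l] and conclusion *)

Lemma composition_series_iso (A : preadditive) (abA : is_abelian A)
    (X X' : A) n :
  isomorphic X X' -> composition_series X n -> composition_series X' n.
Proof.
move=> isoX cX; case: cX isoX => {X n} [X zX|W X S n f g cW sfg sS] isoX.
  exact/comp_series0/(isomorphic_zero isoX).
have [h [h' [h'h hh']]] := isoX.
have [kf eg] := (ses_short_exact abA _ _).1 sfg.
apply: (comp_seriesS (f := h \oc f) (g := g \oc h') cW _ sS).
apply/(ses_short_exact abA); split; last exact: epi_comp eg (split_epi h'h).
apply: is_ker.
- by rewrite compA -(compA g) h'h compm1 (ker0 kf).
- exact: mono_comp (split_mono h'h) (ker_mono kf).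
move=> V x; rewrite -compA => /(ker_lift kf)[u fu].
by exists u; rewrite -compA fu compA hh' comp1m.
Qed.

(** Lengths are bounded over representatives of the simple objects. Finiteness of [L_l] lets a
    finite level of [B] force a finite level of [C]. *)
Lemma L_l_finite (A B C : preadditive) (R : recollement A B C) :
  is_length_category B -> finitely_many_simples C ->
  exists L, (L_l R <= L%:E)%en.
Proof.
move=> [abB lenB] [n [T simT]].
have [len lenT] := fin_all_exists (fun j => lenB (rec_l R (T j))).
exists (\max_j len j); apply/esup_le => S /simT[j [h ih]]; apply/einf_le.
exists (len j); first exact: leq_bigmax.
apply: (composition_series_iso abB) (lenT j); apply: isomorphic_sym.
by exists (fmap (rec_l R) h); apply: functor_iso.
Qed.

(* The subtraction below is truncated; this matters only if L_l = 0, that is,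
   if C is zero. *)
Theorem theorem5p4 (A B C : preadditive) (R : recollement A B C)
    (lenA : is_length_category A) (lenB : is_length_category B)
    (lenC : is_length_category C)
    (finA : finitely_many_simples A) (finB : finitely_many_simples B)
    (finC : finitely_many_simples C)
    (projA : enough_projectives A) (projB : enough_projectives B)
    (projC : enough_projectives C)
    (injA : enough_injectives A) (injB : enough_injectives B)
    (injC : enough_injectives C)
    (OB : syzygies B) (OC : syzygies C)
    (Y' : B -> A) (hY' : unit_cokernels R Y')
    (hpgl : (pgldim R <= 1%:E)%en) :
  (gldim A <= 1%:E)%en /\
  forall k : nat, (1 <= k)%N ->
    [/\ (ddell_cat OC k <= L_l R * (ddell_cat OB k + 1%:E) - 1)%en,
        (ddell_cat OB k <= ddell_cat OC k + 2%:E * L_r Y' + 3%:E)%en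
      & ddell_cat OB k <> None <-> ddell_cat OC k <> None].
Proof.
have [abA _] := lenA; have [abB _] := lenB; have [abC _] := lenC.
have pd_i X : pd_le 1 (rec_i R X).
  by apply/(pd_leP abB projB); move/esup_le: hpgl; apply.
split.
  apply/esup_le => X _; apply/(pd_leP abA projA).
  exact: (pd_le_A abA abB projA projB pd_i).
move=> k _.
have upper c := @ddell_cat_B_le _ _ _ R abB abC projB projC pd_i OB OC k c.
have lower d L :=
  @ddell_cat_C_le _ _ _ R abB abC projB projC pd_i OB OC k d L.
have [L0 leL0] := L_l_finite R lenB finC.
split.
(* If the level of [B] or [L_l R] is infinite, so is the right-hand side. *)
- case: (ddell_cat OB k) lower => [d|]; last first.
    by case: (L_l R) (ddell_cat OC k) => [?|] [?|].
  case: (L_l R) => [L|] lower; last by case: (ddell_cat OC k).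
  by apply: lower => /=.
- case: (ddell_cat OC k) upper => [c|] upper; last by case: (ddell_cat OB k).
  case: (L_r Y') => [L|]; last by case: (ddell_cat OB k).
  (* The bound obtained is [c + 3], and adding [2 * L] preserves the inequality. *)
  apply: ele_trans (upper c (leqnn c)) _ => /=.
  by rewrite -addn3 leq_add2r leq_addr.
split.
  case: (ddell_cat OB k) lower => [d|] // /(_ d L0 (leqnn d) leL0).
  by case: (ddell_cat OC k).
case: (ddell_cat OC k) upper => [c|] // /(_ c (leqnn c)).
by case: (ddell_cat OB k).
Qed.
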